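(* Let $d\in\mathbb{N}$, $d\ge 1$, let $\sigma>0$ and $\theta>0$, and put $\lambda:=\theta/\sigma^2>0$. Let $L>0$ and $x\in[0,L]$, and let $(X_t)_{t\ge 0}$ be the $d$-dimensional Ornstein--Uhlenbeck process solving $\mathrm{d}X_t=-\theta X_t\,\mathrm{d}t+\sigma\,\mathrm{d}B_t$, with initial value satisfying $\|X_0\|_2=x$ almost surely. Let $\tau_L:=\inf\{t\ge 0:\|X_t\|_2=L\}$ and denote its expectation by $\mathbb{E}^x\tau_L$. Then the following upper bounds hold: $$\mathbb{E}^x\tau_L\;\le\;\frac{2}{\sigma^2 d(d+2)}\left(\frac1\lambda\left[e^{\lambda L^2}-e^{\lambda x^2}\right]+\frac d2\left[L^2-x^2\right]\right)\;\le\;\frac1\theta\left[e^{\lambda L^2}-e^{\lambda x^2}\right]d^{-1},$$ and the following lower bounds hold: $$\mathbb{E}^x\tau_L\;\ge\;\frac{1+\frac2d}{2\lambda\sigma^2}\left[\exp\!\left(\frac{2\lambda}{d+2}L^2\right)-\exp\!\left(\frac{2\lambda}{d+2}x^2\right)\right]\;\ge\;\left[\frac{L^2-x^2}{\sigma^2}\right]d^{-1}.$$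
   Context: $B_t$ is a standard $d$-dimensional Brownian motion, $X_0$ is independent of $B$, and $X$ is the (strong) solution of the stated It\^o SDE with initial value $X_0$. $\|\cdot\|_2$ is the Euclidean norm on $\mathbb{R}^d$. The superscript $x$ in $\mathbb{E}^x\tau_L$ only indicates that $\|X_0\|_2=x$ almost surely. *)

(* Defs.v *)
From HB Require Import structures.
From mathcomp Require Import all_boot all_order all_algebra.
From mathcomp Require Import all_classical all_reals all_analysis.

Set Implicit Arguments.
Unset Strict Implicit.
Unset Printing Implicit Defensive.

Import Order.TTheory GRing.Theory Num.Theory.
Import numFieldNormedType.Exports.

Local Open Scope classical_set_scope.
Local Open Scope ring_scope.

(* The norm that the library puts on 'rV[R]_d is the sup norm. *)
Definition eucl_norm (R : realType) (d : nat) (v : 'rV[R]_d) : R :=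
  Num.sqrt (\sum_(i < d) v 0 i ^+ 2).

(* The sigma-algebra on T generated by the functions Y i, i in D. *)
Definition sigma_family (R : realType) (T I : Type) (D : set I)
    (Y : I -> T -> R) : set_system T :=
  <<s \bigcup_(i in D) preimage_set_system setT (Y i) measurable >>.

(* sigma(Y t; t in D) for an R^d-valued family: the Borel sigma-algebra of R^d
   is generated by the coordinate maps. *)
Definition sigma_process (R : realType) (T : Type) (d : nat) (D : set R)
    (Y : R -> T -> 'rV[R]_d) : set_system T :=
  sigma_family (D `*` [set: 'I_d]) (fun p w => Y p.1 w 0 p.2).

Definition independent2 (disp : measure_display) (T : measurableType disp)
    (R : realType) (P : probability T R) (F G : set_system T) : Prop :=
  forall A B : set T, F A -> G B -> P (A `&` B) = (P A * P B)%E.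

Definition mutually_independent (disp : measure_display)
    (T : measurableType disp) (R : realType) (P : probability T R)
    (I : finType) (F : I -> set_system T) : Prop :=
  forall (J : {set I}) (A : I -> set T),
    (forall i, i \in J -> F i (A i)) ->
    P (\bigcap_(i in [set` J]) A i) = (\prod_(i in J) P (A i))%E.

(* Processes are indexed by R, but only times t >= 0 are ever constrained. *)
Record standard_BM1 (disp : measure_display) (T : measurableType disp)
    (R : realType) (P : probability T R) (W : R -> T -> R) : Prop := {
  bm1_measurable : forall t, 0 <= t -> measurable_fun [set: T] (W t);
  bm1_start : \forall w \ae P, W 0 w = 0;
  bm1_independent_increments : forall (n : nat) (t : nat -> R),
    0 <= t 0%N -> nondecreasing_seq t ->
    mutually_independent P (fun k : 'I_n =>
      preimage_set_system [set: T] (fun w => W (t k.+1) w - W (t k) w)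
        measurable);
  (* the second parameter of normal_prob is the standard deviation *)
  bm1_gaussian_increments : forall s t, 0 <= s -> s < t ->
    forall A : set R, measurable A ->
    pushforward P (fun w => W t w - W s w) A
    = normal_prob 0 (Num.sqrt (t - s)) A;
  bm1_continuous : \forall w \ae P,
    {within [set` `[0, +oo[], continuous (fun t => W t w)}
}.

Record standard_BM (disp : measure_display) (T : measurableType disp)
    (R : realType) (P : probability T R) (d : nat)
    (B : R -> T -> 'rV[R]_d) : Prop := {
  bm_coord : forall i : 'I_d, standard_BM1 P (fun t w => B t w 0 i);
  bm_coord_independent : mutually_independent P (fun i : 'I_d =>
    sigma_family [set t | 0 <= t] (fun t w => B t w 0 i))
}.

(* The P-augmentation of sigma(xi, B s; 0 <= s <= t), where xi = X 0. *)
Definition augmented_filtration (disp : measure_display)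
    (T : measurableType disp) (R : realType) (P : probability T R) (d : nat)
    (B X : R -> T -> 'rV[R]_d) (t : R) : set_system T :=
  <<s sigma_process [set 0] X `|` sigma_process [set` `[0, t]] B
      `|` P.-negligible >>.

(* X is a strong solution of dX = - theta X dt + sigma dB.  The diffusion
   coefficient is the constant sigma, so the Ito integral of sigma over [0, t]
   is that of a simple integrand, sigma (B t - B 0); the drift term is a
   pathwise Lebesgue integral.  The equation is written coordinatewise. *)
Record OU_strong_solution (disp : measure_display) (T : measurableType disp)
    (R : realType) (P : probability T R) (d : nat) (theta sigma : R)
    (B X : R -> T -> 'rV[R]_d) : Prop := {
  ou_measurable : forall t (i : 'I_d), 0 <= t ->
    measurable_fun [set: T] (fun w => X t w 0 i);
  ou_adapted : forall t, 0 <= t ->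
    sigma_process [set t] X `<=` augmented_filtration P B X t;
  ou_continuous : \forall w \ae P,
    {within [set` `[0, +oo[], continuous (fun t => X t w)};
  ou_equation : \forall w \ae P, forall t (i : 'I_d), 0 <= t ->
    X t w 0 i = X 0 w 0 i
      - theta * (\int[lebesgue_measure]_(s in [set` `[0, t]]) X s w 0 i)
      + sigma * (B t w 0 i - B 0 w 0 i)
}.

(* inf {t >= 0 : |X t| = L}, equal to +oo when the level is never reached. *)
Definition hitting_time (T : Type) (R : realType) (d : nat)
    (X : R -> T -> 'rV[R]_d) (L : R) (w : T) : \bar R :=
  ereal_inf [set t%:E | t in [set t : R | 0 <= t /\ eucl_norm (X t w) = L]].

(* 'E_P[_] is only available for R-valued functions. *)
Definition expected_hitting_time (disp : measure_display)
    (T : measurableType disp) (R : realType) (P : probability T R) (d : nat)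
    (X : R -> T -> 'rV[R]_d) (L : R) : \bar R :=
  (\int[P]_w hitting_time X L w)%E.

(* Main.v *)
Require Import Defs.
From HB Require Import structures.
From mathcomp Require Import all_boot all_order all_algebra.
From mathcomp Require Import all_classical all_reals all_analysis.
From mathcomp Require Import measurable_realfun ring lra.

Set Implicit Arguments.
Unset Strict Implicit.
Unset Printing Implicit Defensive.

Import Order.TTheory GRing.Theory Num.Theory.
Import numFieldNormedType.Exports.

Local Open Scope classical_set_scope.
Local Open Scope ring_scope.

(* Let g(r) = alpha exp(mu r) + beta r.  Along the process, g(|X|^2) has drift
   G(|X|^2), where G(r) = g'(r) (sigma^2 d - 2 theta r) + 2 sigma^2 r g''(r).  The
   upper bound comes from a choice of g with mu = lambda and G >= 1, the lower
   bound from one with mu = 2 lambda / (d + 2), beta = 0 and G <= 1, since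
   g(L^2) - g(x^2) is the mean of the integral of G(|X|^2) up to the hitting time;
   both inequalities for G reduce to 1 + u <= exp u.

   No stochastic integration is needed: the noise is additive, so on a grid the
   increments of X are those of sigma B plus a drift.  The expansion of g to second
   order along the stopped grid process has a martingale part of mean zero, because
   the increments of B are independent of the augmented past, and an error that
   vanishes with the mesh.  Along almost every path the exit time of the grid process
   from a ball converges, by uniform continuity, to that of X.  The hitting time
   is not known to be measurable, so the limit is taken through simple functions
   below it (upper bound) and through measurable minorants (lower bound). *)

(** * Independence of the past and the increments *)

(** Several devices keep means finite and errors uniform. The last step of the scheme may overshoot
    the ball by an unbounded Gaussian amount, so g is evaluated at the squared radius capped at a
    level M above [l2]. The drift over one grid cell is controlled only path by path, so it is
    clipped at a constant times the time step: its error then has a constant majorant, and its mean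
    vanishes by dominated convergence. The squared radius [l2] of the ball differs in the two
    bounds. For the upper bound it is L^2, since a grid point outside the ball forces an earlier
    crossing of the sphere. For the lower bound it is strictly smaller, since a path may touch the
    sphere between two grid points while every grid point stays inside; [l2] increases to L^2 at the
    end. The filtration is augmented by null sets, so the past is handled through sets that agree
    with a set of a generated sigma-algebra off a null set. *)

Section independence.
Context (disp : measure_display) (T : measurableType disp) (R : realType)
  (P : probability T R).

(** Restricting [P] to [C] and scaling [P] by [P C] give two finite measures; they agree on the
    pi-system [G] and on the whole space, hence on the generated sigma-algebra. *)
Lemma indep_g_sigma (G : set_system T) (C : set T) :
  measurable C -> setI_closed G -> G `<=` measurable ->
  (forall A, G A -> P (A `&` C) = (P A * P C)%E) ->
  forall A, <<s G >> A -> P (A `&` C) = (P A * P C)%E.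
Proof.
move=> mC GI Gm GC A sA.
have c0 : 0 <= fine (P C) by rewrite fine_ge0.
have PCE : (fine (P C))%:E = P C by rewrite fineK// fin_num_measure.
have HG : [set X | G X /\ X `<=` setT] = G.
  by apply/seteqP; split => [X []//|X GX]; split.
have m1E X : mrestr P mC X = P (X `&` C) by [].
have m2E X : mscale (NngNum c0) P X = (P X * P C)%E.
  by rewrite muleC; congr (_ * _)%E; exact: PCE.
have := @g_sigma_algebra_measure_unique_trace _ R T G setT.
rewrite HG => /(_ measurableT Gm GI (mrestr P mC) (mscale (NngNum c0) P)) H.
rewrite -m1E -m2E; apply: H => //.
- by apply/esym/(etrans (m2E _))/esym/(etrans (m1E _)); rewrite setTI probability_setT mul1e.
- by move=> X GX; apply/(etrans (m1E _))/esym/(etrans (m2E _)); rewrite GC.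
- by rewrite [X in (X < _)%E]m1E ltey_eq fin_num_measure// setTI.
Qed.

(** The completion of the generated sigma-algebra, encoded as agreement off a null set. It absorbs
    the null sets of the augmented filtration while [G] remains a pi-system of measurable sets. *)
Definition almost_sigma (G : set_system T) : set_system T :=
  [set A | exists A' N, [/\ <<s G >> A', P.-negligible N &
     forall w, ~ N w -> (A w <-> A' w)]].

Lemma almost_sigma_algebra (G : set_system T) :
  sigma_algebra setT (almost_sigma G).
Proof.
split.
- exists set0, set0; split => //; [exact: sigma_algebra0 | exact: negligible_set0].
- move=> A [A' [N [sA nN AA']]]; exists (setT `\` A'), N; split => //.
    exact: sigma_algebraCD.
  by move=> w /AA' e; split => -[_ h]; split => //; rewrite ?e// -?e.
- move=> A /choice[A'] /choice[N] h.
  exists (\bigcup_k A' k), (\bigcup_k N k); split.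
  + by apply: sigma_algebra_bigcup => k; have [] := h k.
  + by apply: negligible_bigcup => k; have [] := h k.
  + move=> w nw; split => -[k _ kw]; exists k => //; have [_ _ e] := h k.
      by apply/e => // Nk; apply: nw; exists k.
    by apply/e => // Nk; apply: nw; exists k.
Qed.

Lemma almost_sigma_sub (G : set_system T) : <<s G >> `<=` almost_sigma G.
Proof.
move=> A GA; exists A, set0; split => //; exact: negligible_set0.
Qed.

Lemma almost_sigma_negligible (G : set_system T) :
  P.-negligible `<=` almost_sigma G.
Proof.
by move=> A nA; exists set0, A; split => //; exact: sigma_algebra0.
Qed.

Lemma g_sigma_measurable (G : set_system T) :
  G `<=` measurable -> <<s G >> `<=` measurable.
Proof. by apply: smallest_sub; exact: sigma_algebra_measurable. Qed.

Lemma almost_sigma_indep (G : set_system T) (C : set T) :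
  measurable C -> setI_closed G -> G `<=` measurable ->
  (forall A, G A -> P (A `&` C) = (P A * P C)%E) ->
  forall A, measurable A -> almost_sigma G A -> P (A `&` C) = (P A * P C)%E.
Proof.
move=> mC GI Gm GC A mA [A' [N [sA' [N0 [mN0 PN0 NN0]] AA']]].
have mA' : measurable A' by exact: g_sigma_measurable sA'.
(* Removing a measurable null cover of [N] changes no probability, and makes the two sets equal. *)
have eqP D D' : measurable D -> measurable D' ->
    (forall w, ~ N w -> (D w <-> D' w)) -> P D = P D'.
  move=> mD mD' DD'.
  have nul E : measurable E -> P E = P (E `\` N0).
    move=> mE; rewrite (measureDI P mE mN0) [X in (_ + X)%E](_ : _ = 0%E) ?adde0//.
    by apply: (subset_measure0 _ mN0) => //; exact: measurableI.
  rewrite (nul D)// (nul D')//; congr (P _); apply/seteqP.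
  by split => w [Dw N0w]; split => //; apply/DD' => // /NN0.
rewrite (eqP (A `&` C) (A' `&` C)); last 3 first.
- exact: measurableI.
- exact: measurableI.
- by move=> w /AA' e; split => -[? ?]; split => //; apply/e.
by rewrite (eqP A A')//; exact: (indep_g_sigma mC GI Gm GC).
Qed.

End independence.

Section sigma_family_theory.
Context (disp : measure_display) (T : measurableType disp) (R : realType).
Implicit Types (I : Type).

Lemma sub_sigma_family I (D D' : set I) (Y : I -> T -> R) :
  D `<=` D' -> sigma_family D Y `<=` sigma_family D' Y.
Proof.
move=> DD'; apply: sub_sigma_algebra2.
by move=> A [i Di Ai]; exists i => //; exact: DD'.
Qed.

Lemma sigma_family_preimage I (D : set I) (Y : I -> T -> R) i (U : set R) :
  D i -> measurable U -> sigma_family D Y (Y i @^-1` U).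
Proof.
move=> Di mU; apply: sub_sigma_algebra; exists i => //; exists U => //.
by rewrite setTI.
Qed.

Lemma sigma_family_ind I (D : set I) (Y : I -> T -> R) (G : set_system T) :
  sigma_algebra setT G ->
  (forall i (U : set R), D i -> measurable U -> G (Y i @^-1` U)) ->
  sigma_family D Y `<=` G.
Proof.
move=> sG GY; apply: smallest_sub => // A [i Di [U mU <-]].
by rewrite setTI; exact: GY.
Qed.

Lemma sigma_family_measurable I (D : set I) (Y : I -> T -> R) :
  (forall i, D i -> measurable_fun setT (Y i)) ->
  sigma_family D Y `<=` measurable.
Proof.
move=> mY; apply: sigma_family_ind; first exact: sigma_algebra_measurable.
by move=> i U Di mU; rewrite -[X in measurable X]setTI; exact: mY.
Qed.

End sigma_family_theory.

Lemma g_sigma_setI (T : Type) (G : set_system T) (A A' : set T) :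
  <<s G >> A -> <<s G >> A' -> <<s G >> (A `&` A').
Proof.
move=> sA sA'; have -> : A `&` A' = setT `\` ((setT `\` A) `|` (setT `\` A')).
  by rewrite !setTD setCU !setCK.
apply: sigma_algebraCD; rewrite -bigcup2E; apply: sigma_algebra_bigcup => -[|[|k]].
- exact: sigma_algebraCD.
- exact: sigma_algebraCD.
- exact: sigma_algebra0.
Qed.

Section BM1_independence.
Context (disp : measure_display) (T : measurableType disp) (R : realType)
  (P : probability T R) (W : R -> T -> R) (hW : standard_BM1 P W).

(* Sorting [l] together with [0] and [t] writes each [W s], [s \in l], as a sum
   of increments over consecutive times, up to the null event [W 0 <> 0]. *)
Lemma BM1_indep_list (l : seq R) (t u : R) (V : set R) (A : set T) :
  0 <= t -> t <= u -> measurable V ->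
  (forall s, s \in l -> 0 <= s <= t) ->
  sigma_family [set s | s \in l] W A ->
  P (A `&` (fun w => W u w - W t w) @^-1` V) =
  (P A * P ((fun w => (W u w - W t w)%R) @^-1` V))%E.
Proof.
move=> t0 tu mV hl sA.
pose q := 0 :: rcons (sort <=%O l) t.
pose n := (size l).+1.
have szq : size q = n.+1 by rewrite /= size_rcons size_sort.
(* The default value is [u]: reading just past the end of [q] gives [tau n.+1 = u], so that the
   increment from [t] to [u] is the last one, [xi n]. *)
pose tau k := nth u q k.
have tau0 : tau 0%N = 0 by [].
have taun : tau n = t.
  by rewrite /tau /q /n /= nth_rcons size_sort ltnn eqxx.
have tauSn : tau n.+1 = u by rewrite /tau nth_default// szq.
have sq : path <=%O 0 (rcons (sort <=%O l) t).
  rewrite rcons_path; apply/andP; split.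
    rewrite path_sortedE; last exact: le_trans.
    rewrite sort_le_sorted andbT; apply/allP => s.
    by rewrite mem_sort => /hl/andP[].
  have := mem_last 0 (sort <=%O l); rewrite inE => /predU1P[->//|].
  by rewrite mem_sort => /hl/andP[].
have allq k : (k < n.+1)%N -> tau k <= t.
  move=> kn; have : tau k \in q by rewrite mem_nth// szq.
  rewrite /q inE => /predU1P[->//|]; rewrite mem_rcons inE => /predU1P[->//|].
  by rewrite mem_sort => /hl/andP[].
have ndtau : nondecreasing_seq tau.
  apply/nondecreasing_seqP => k.
  have [kn|] := ltnP k.+1 n.+1.
    have /(pathP u) := sq => /(_ k); apply.
    by rewrite size_rcons size_sort.
  rewrite leq_eqVlt => /predU1P[e|kn].
    by rewrite -e tauSn; apply: (le_trans _ tu); apply: allq; rewrite e.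
  by rewrite /tau !nth_default// szq ?ltnS// ltnW.
have tau_ge0 k : 0 <= tau k by rewrite -tau0; exact: ndtau.
pose xi k w := W (tau k.+1) w - W (tau k) w.
have mxi k : measurable_fun setT (xi k).
  by apply: measurable_funB; apply: (bm1_measurable hW).
(* Cylinders over the increments before [t], a pi-system on which independence of increments applies
   directly. *)
pose G := [set A : set T | exists U : nat -> set R,
  (forall k, measurable (U k)) /\ A = \bigcap_(k < n) (xi k @^-1` U k)].
have GI : setI_closed G.
  move=> _ _ [U [mU ->]] [U' [mU' ->]].
  exists (fun k => U k `&` U' k); split; first by move=> k; exact: measurableI.
  by rewrite -bigcapI; apply: eq_bigcapr => k _; rewrite preimage_setI.
have mxiU k U : measurable U -> measurable (xi k @^-1` U).
  by move=> mU; rewrite -[X in measurable X]setTI; exact: mxi.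
have Gm : G `<=` measurable.
  move=> _ [U [mU ->]]; apply: bigcap_measurable => //; first by exists 0%N.
  by move=> k _; exact: mxiU.
have indep (U : nat -> set R) : (forall k, measurable (U k)) ->
  P (\bigcap_(k < n.+1) (xi k @^-1` U k)) =
  (\prod_(k < n.+1) P (xi k @^-1` U k))%E.
  move=> mU.
  have := bm1_independent_increments hW (n := n.+1) (tau_ge0 0%N) ndtau.
  move=> /(_ [set: 'I_n.+1]%SET (fun k => xi k @^-1` U k)).
  rewrite (_ : \bigcap_(i in [set` [set: 'I_n.+1]%SET]) _ =
    \bigcap_(k < n.+1) (xi k @^-1` U k)); last first.
    apply/seteqP; split => w hw.
      by move=> k kn; apply: (hw (Ordinal kn)); rewrite /= inE.
    by move=> k _; apply: hw => /=; exact: ltn_ord.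
  move=> ->; first by apply: eq_bigl => k; rewrite inE.
  by move=> k _; exists (U k) => //; rewrite setTI.
have GC B : G B -> P (B `&` xi n @^-1` V) = (P B * P (xi n @^-1` V))%E.
  move=> [U [mU ->]].
  have E (V' : set R) : measurable V' ->
     P (\bigcap_(k < n) (xi k @^-1` U k) `&` xi n @^-1` V') =
     (\prod_(k < n) P (xi k @^-1` U k) * P (xi n @^-1` V'))%E.
    move=> mV'.
    pose U' k := if (k < n)%N then U k else V'.
    have U'n : U' n = V' by rewrite /U' ltnn.
    have U'k (k : 'I_n) : U' k = U k by rewrite /U' ltn_ord.
    transitivity (\prod_(k < n.+1) P (xi k @^-1` U' k))%E; last first.
      by rewrite big_ord_recr /= U'n; under eq_bigr do rewrite U'k.
    rewrite -indep; last by move=> k; rewrite /U'; case: ifP.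
    congr (P _).
    apply/seteqP; split => w.
      move=> [h1 h2] k /=; rewrite ltnS leq_eqVlt => /predU1P[->|kn].
        by rewrite /U' ltnn.
      by rewrite /U' kn; exact: h1.
    move=> h; split.
      by move=> k /= kn; have := h k; rewrite /U' /= kn ltnS ltnW//; apply.
    by have := h n; rewrite /U' /= ltnn ltnS leqnn; apply.
  (* Taking the whole line for [V'] identifies the product with the probability of the cylinder. *)
  rewrite E// (_ : P (\bigcap_(k < n) _) = \prod_(k < n) P (xi k @^-1` U k))%E//.
  by have := E setT measurableT; rewrite preimage_setT setIT probability_setT mule1.
have -> : (fun w => W u w - W t w) = xi n.
  by rewrite /xi tauSn taun.
have mV' := mxiU n V mV.
have WT s : s \in l -> measurable_fun setT (W s).
  by move=> /hl /andP[s0 _]; exact: (bm1_measurable hW).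
apply: (almost_sigma_indep mV' GI Gm GC).
  by apply: sigma_family_measurable sA => s; exact: WT.
have := sA; apply: sigma_family_ind; first exact: almost_sigma_algebra.
move=> s U sl mU.
have [j jn sE] : exists2 j, (j <= n)%N & tau j = s.
  have sq' : s \in q by rewrite /q inE mem_rcons inE mem_sort sl !orbT.
  exists (index s q); first by rewrite -ltnS -szq index_mem.
  by rewrite /tau nth_index.
have [N0 [mN0 PN0 hN0]] := bm1_start hW.
exists ((fun w => \sum_(k < j) xi k w) @^-1` U), N0; split.
- have mxiG k : (k < n)%N -> measurable_fun (setT : set (g_sigma_algebraType G)) (xi k).
    move=> kn _ U' mU'; rewrite setTI; apply: sub_sigma_algebra.
    exists (fun k' => if k' == k then U' else setT); split.
      by move=> k'; case: ifP.
    apply/seteqP; split => w.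
      by move=> h k' /= k'n; case: eqVneq => [->|].
    by move=> /(_ k kn); rewrite eqxx.
  have : measurable_fun (setT : set (g_sigma_algebraType G)) (fun w => \sum_(k < j) xi k w).
    by apply: measurable_sum => k; apply: mxiG; exact: leq_trans jn.
  by move=> /(_ measurableT U mU); rewrite setTI.
- by exists N0; split.
- move=> w Nw; have W0 : W 0 w = 0 by apply: contrapT => h; apply: Nw; exact: hN0.
  suff e : W s w = \sum_(k < j) xi k w by rewrite /preimage /= e.
  rewrite -sE -(big_mkord xpredT (fun k => xi k w)) telescope_sumr//.
  by rewrite tau0 W0 subr0.
Qed.

(** The events that depend on finitely many times of [0, t] form a pi-system, by concatenation of
    the lists of times, and they generate the past of [W]. *)
Lemma BM1_indep (t u : R) (V : set R) (A : set T) :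
  0 <= t -> t <= u -> measurable V ->
  sigma_family [set` `[0, t]] W A ->
  P (A `&` (fun w => W u w - W t w) @^-1` V) =
  (P A * P ((fun w => (W u w - W t w)%R) @^-1` V))%E.
Proof.
move=> t0 tu mV.
pose G := [set A : set T | exists2 l : seq R,
  (forall s, s \in l -> 0 <= s <= t) & sigma_family [set s | s \in l] W A].
have mW s : 0 <= s -> measurable_fun setT (W s) by exact: (bm1_measurable hW).
have mC : measurable ((fun w => W u w - W t w) @^-1` V).
  rewrite -[X in measurable X]setTI; apply: measurable_funB => //.
    by apply: mW; exact: le_trans tu.
  exact: mW.
have GI : setI_closed G.
  move=> A1 A2 [l1 hl1 A1l] [l2 hl2 A2l]; exists (l1 ++ l2).
    by move=> s; rewrite mem_cat => /orP[/hl1|/hl2].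
  apply: g_sigma_setI.
    by apply: sub_sigma_family A1l => s /= sl; rewrite mem_cat sl.
  by apply: sub_sigma_family A2l => s /= sl; rewrite mem_cat sl orbT.
have Gm : G `<=` measurable.
  move=> A1 [l hl]; apply: sigma_family_measurable => s /= /hl /andP[s0 _].
  exact: mW.
have GC A1 : G A1 -> P (A1 `&` (fun w => W u w - W t w) @^-1` V) =
    (P A1 * P ((fun w => (W u w - W t w)%R) @^-1` V))%E.
  by move=> [l hl A1l]; exact: (BM1_indep_list t0 tu mV hl A1l).
move=> sA; apply: (indep_g_sigma mC GI Gm GC).
have := sA; apply: sigma_family_ind; first exact: smallest_sigma_algebra.
move=> s U; rewrite /= in_itv /= => s0t mU; apply: sub_sigma_algebra.
exists [:: s]; first by move=> s'; rewrite inE => /eqP->.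
by apply: sigma_family_preimage => //=; rewrite inE.
Qed.

End BM1_independence.

Section past.
Context (disp : measure_display) (Omega : measurableType disp) (R : realType)
  (P : probability Omega R) (d : nat) (B X : R -> Omega -> 'rV[R]_d).
Hypothesis hB : standard_BM P B.
Hypothesis hindep : independent2 P (sigma_process [set 0] X)
                                   (sigma_process [set t | 0 <= t] B).
Hypothesis mX0 : forall i, measurable_fun setT (fun w => X 0 w 0 i).

Let Bc (i : 'I_d) (t : R) (w : Omega) : R := B t w 0 i.

(* The coordinates of [B] other than [j] are revealed for all times: an increment
   of coordinate [j] is independent even of this larger class, and this makes the
   mean of a product of increments of two distinct coordinates vanish. *)
Definition past_rectangle (j : 'I_d) (t : R) : set_system Omega :=
  [set A | exists F G, [/\ sigma_process [set 0] X F,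
     forall i, sigma_family (if i == j then [set` `[0, t]] else [set s | 0 <= s])
                 (Bc i) (G i)
   & A = F `&` \bigcap_(i in [set: 'I_d]) G i] ].

Lemma g_sigma_bigcap_ord (G0 : set_system Omega) (H : 'I_d -> set Omega) :
  (forall i, <<s G0 >> (H i)) -> <<s G0 >> (\bigcap_(i in [set: 'I_d]) H i).
Proof.
move=> sH.
apply: (@fin_bigcap_measurable _ (g_sigma_algebraType G0) _ setT H).
  exact: finite_finset.
by move=> i _; exact: sH.
Qed.

Lemma past_rectangle_setI j t : setI_closed (past_rectangle j t).
Proof.
move=> _ _ [F [G [sF sG ->]]] [F' [G' [sF' sG' ->]]].
exists (F `&` F'), (fun i => G i `&` G' i); split.
- exact: g_sigma_setI.
- by move=> i; apply: g_sigma_setI; [exact: sG|exact: sG'].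
- by rewrite bigcapI setIACA.
Qed.

Lemma itv_sub_ge0 (t : R) : [set` `[0, t]] `<=` [set s : R | 0 <= s].
Proof. by move=> s /=; rewrite in_itv /= => /andP[]. Qed.

Lemma sigma_coord_sub (D : set R) i :
  sigma_family D (Bc i) `<=` sigma_process D B.
Proof.
apply: sigma_family_ind; first exact: smallest_sigma_algebra.
move=> s U Ds mU.
exact: (@sigma_family_preimage _ _ _ _ (D `*` setT)
  (fun p w => B p.1 w 0 p.2) (s, i)).
Qed.

Lemma past_rectangle_measurable j t : past_rectangle j t `<=` measurable.
Proof.
move=> _ [F [G [sF sG ->]]]; apply: measurableI.
  by apply: sigma_family_measurable sF => -[s i] /= [-> _]; exact: mX0.
apply: fin_bigcap_measurable; first exact: finite_finset.
move=> i _; apply: sigma_family_measurable (sG i) => s.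
case: ifP => _ /= h; apply: (bm1_measurable (bm_coord hB i)) => //.
exact: itv_sub_ge0 h.
Qed.

(** The increment event is absorbed into the factor of coordinate [j]. Independence of [X 0] from
    [B], and of the coordinates from each other, splits the rectangle into factors; the factor [j]
    splits further by [BM1_indep]. *)
Lemma past_rectangle_indep j t u V A :
  0 <= t -> t <= u -> measurable V -> past_rectangle j t A ->
  P (A `&` (fun w => Bc j u w - Bc j t w) @^-1` V) =
  (P A * P ((fun w => (Bc j u w - Bc j t w)%R) @^-1` V))%E.
Proof.
move=> t0 tu mV [F [G [sF sG ->]]].
set C := _ @^-1` V.
have u0 : 0 <= u by exact: le_trans tu.
have sC : sigma_family [set s | 0 <= s] (Bc j) C.
  pose G0 := \bigcup_(i in [set s | 0 <= s]) preimage_set_system setT (Bc j i) measurable.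
  have m s : 0 <= s -> measurable_fun (setT : set (g_sigma_algebraType G0)) (Bc j s).
    by move=> s0 _ U mU; rewrite setTI; exact: sigma_family_preimage.
  have /(_ measurableT V mV) := measurable_funB (m _ u0) (m _ t0).
  by rewrite setTI.
have sG0 i : sigma_family [set s | 0 <= s] (Bc i) (G i).
  by apply: sub_sigma_family (sG i); case: ifP => _; [move=> s /itv_sub_ge0|].
have key (H : 'I_d -> set Omega) :
  (forall i, sigma_family [set s | 0 <= s] (Bc i) (H i)) ->
  P (F `&` \bigcap_(i in [set: 'I_d]) H i) = (P F * \prod_(i < d) P (H i))%E.
  move=> sH; rewrite hindep//.
    congr (_ * _)%E.
    have := bm_coord_independent hB (J := [set: 'I_d]%SET) (A := H).
    rewrite (_ : [set` [set: 'I_d]%SET] = setT); last first.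
      by apply/seteqP; split => // i _ /=; rewrite inE.
    move=> ->; first by apply: eq_bigl => i; rewrite inE.
    by move=> i _; exact: sH.
  apply: g_sigma_bigcap_ord => i.
  by apply: sigma_coord_sub; exact: sH.
rewrite -setIA.
have -> : \bigcap_(i in [set: 'I_d]) G i `&` C =
    \bigcap_(i in [set: 'I_d]) (if i == j then G i `&` C else G i).
  apply/seteqP; split => w.
    by move=> [Gw Cw] i _; case: ifP => _; [split => //|]; exact: Gw.
  move=> h; split; last by have := h j I; rewrite eqxx => -[].
  by move=> i _; have := h i I; case: ifP => // _ [].
rewrite !key//; last first.
  by move=> i; case: eqP => [->|_]//; apply: g_sigma_setI => //; exact: sG0.
rewrite (bigD1 j)//= [in RHS](bigD1 j)//= eqxx.
under eq_bigr => i /negbTE ij do rewrite ij.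
rewrite -!muleA; congr (_ * _)%E.
rewrite (BM1_indep (bm_coord hB j) t0 tu mV); last by have := sG j; rewrite eqxx.
by rewrite -!muleA; congr (_ * _)%E; rewrite muleC.
Qed.

End past.

Lemma g_sigma_setT (T : Type) (G : set_system T) : <<s G >> setT.
Proof.
have := @sigma_algebraCD _ setT G set0 (@sigma_algebra0 _ setT G).
by rewrite setD0.
Qed.

Section past_filtration.
Context (disp : measure_display) (Omega : measurableType disp) (R : realType)
  (P : probability Omega R) (d : nat) (B X : R -> Omega -> 'rV[R]_d).
Hypothesis hB : standard_BM P B.
Hypothesis hindep : independent2 P (sigma_process [set 0] X)
                                   (sigma_process [set t | 0 <= t] B).
Hypothesis mX : forall t i, 0 <= t -> measurable_fun setT (fun w => X t w 0 i).
Hypothesis adX : forall t, 0 <= t ->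
    sigma_process [set t] X `<=` augmented_filtration P B X t.

Let mX0 i : measurable_fun setT (fun w => X 0 w 0 i).
Proof. exact: mX. Qed.

Let mB t i : 0 <= t -> measurable_fun setT (fun w => B t w 0 i).
Proof. by move=> t0; exact: (bm1_measurable (bm_coord hB i)). Qed.

(** The intersection with [measurable] discards the sets that differ from a measurable one by a
    non-measurable part of a null set. *)
Definition past (j : 'I_d) (t : R) : set_system Omega :=
  measurable `&` almost_sigma P (past_rectangle B X j t).

Lemma past_sigma_algebra j t : sigma_algebra setT (past j t).
Proof.
have [m0 mC mU] := @sigma_algebra_measurable _ Omega.
have [a0 aC aU] := almost_sigma_algebra P (past_rectangle B X j t).
split; first by split.
- by move=> A [mA aA]; split; [exact: mC|exact: aC].
- move=> A hA; split; [apply: mU|apply: aU] => k; by case: (hA k).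
Qed.

Lemma past_indep j t u V A :
  0 <= t -> t <= u -> measurable V -> past j t A ->
  P (A `&` (fun w => B u w 0 j - B t w 0 j) @^-1` V) =
  (P A * P ((fun w => (B u w 0 j - B t w 0 j)%R) @^-1` V))%E.
Proof.
move=> t0 tu mV [mA aA].
apply: (almost_sigma_indep _ _ _ _ mA aA).
- rewrite -[X in measurable X]setTI.
  by apply: measurable_funB => //; apply: mB => //; exact: le_trans tu.
- exact: past_rectangle_setI.
- exact: (past_rectangle_measurable hB mX0).
- by move=> A'; exact: (past_rectangle_indep hB hindep).
Qed.

Let rect_coord (j : 'I_d) (t : R) (i : 'I_d) A :
  sigma_family (if i == j then [set` `[0, t]] else [set s | 0 <= s])
    (fun s w => B s w 0 i) A -> past_rectangle B X j t A.
Proof.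
move=> sA; exists setT, (fun i' => if i' == i then A else setT); split.
- by apply: g_sigma_setT.
- move=> i'; case: (eqVneq i' i) => [->//|_]; by apply: g_sigma_setT.
- rewrite setTI; apply/seteqP; split => w.
    by move=> Aw i' _; case: ifP.
  by move=> /(_ i I); rewrite eqxx.
Qed.

Lemma past_mB j t s i : 0 <= s -> (i == j -> s <= t) ->
  measurable_fun (setT : set (g_sigma_algebraType (past j t)))
    (fun w => B s w 0 i).
Proof.
move=> s0 st _ U mU; apply: sub_sigma_algebra; split.
  exact: mB.
rewrite setTI; apply: almost_sigma_sub; apply: sub_sigma_algebra.
apply: (@rect_coord j t i).
apply: (@sigma_family_preimage _ _ _ _ _ (fun s w => B s w 0 i)) => //.
by case: ifP => [ij|_] //=; rewrite in_itv /= s0 st.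
Qed.

(** Adaptedness enters here: the three kinds of generators of the augmented filtration (events of
    [X 0], events of [B] up to [s], null sets) all lie in the completed class of rectangles. *)
Lemma past_mX j t s i : 0 <= s <= t ->
  measurable_fun (setT : set (g_sigma_algebraType (past j t)))
    (fun w => X s w 0 i).
Proof.
move=> /andP[s0 st] _ U mU; apply: sub_sigma_algebra; split.
  exact: mX.
have : augmented_filtration P B X s (setT `&` (fun w => X s w 0 i) @^-1` U).
  apply: adX => //; rewrite setTI.
  exact: (@sigma_family_preimage _ _ _ _ ([set s] `*` setT)
    (fun p w => X p.1 w 0 p.2) (s, i)).
move: (setT `&` _) => A; apply: smallest_sub; first exact: almost_sigma_algebra.
move=> {}A [[]|].
- move=> sA; apply: almost_sigma_sub; apply: sub_sigma_algebra.
  exists A, (fun=> setT); split => //; last by apply/seteqP; split => [w Aw|w []//]; split.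
  by move=> i'; by apply: g_sigma_setT.
- apply: sigma_family_ind; first exact: almost_sigma_algebra.
  move=> -[s' i'] V [/= +  _] mV; rewrite in_itv /= => /andP[s'0 s's].
  apply: almost_sigma_sub; apply: sub_sigma_algebra.
  apply: (@rect_coord j t i').
  apply: (@sigma_family_preimage _ _ _ _ _ (fun s w => B s w 0 i')) => //.
  by case: ifP => [ij|_] //=; rewrite in_itv /= s'0 (le_trans s's).
- exact: almost_sigma_negligible.
Qed.

End past_filtration.

Section indep_expectation.
Context (disp : measure_display) (T : measurableType disp) (R : realType)
  (P : probability T R).
Variables (Y Z : T -> R).
Hypotheses (iY : P.-integrable setT (EFin \o Y))
  (iZ : P.-integrable setT (EFin \o Z)).
Hypothesis YZ : forall U V : set R, measurable U -> measurable V ->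
  P (Y @^-1` U `&` Z @^-1` V) = (P (Y @^-1` U) * P (Z @^-1` V))%E.

Let mY : measurable_fun setT Y.
Proof. by apply/measurable_EFinP; exact: (measurable_int P iY). Qed.
Let mZ : measurable_fun setT Z.
Proof. by apply/measurable_EFinP; exact: (measurable_int P iZ). Qed.

Let mYZ : measurable_fun setT (fun w => (Y w, Z w)).
Proof. exact: measurable_fun_pair. Qed.

HB.instance Definition _ := isMeasurableFun.Build _ _ _ _ Y mY.
HB.instance Definition _ := isMeasurableFun.Build _ _ _ _ Z mZ.
Let pairYZ w := (Y w, Z w).
HB.instance Definition _ := isMeasurableFun.Build _ _ _ _ pairYZ mYZ.

Let muY : probability R R := distribution P Y.
Let muZ : probability R R := distribution P Z.
Let f (p : R * R) : \bar R := (p.1 * p.2)%:E.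

Let mf : measurable_fun setT f.
Proof.
apply/measurable_EFinP; apply: measurable_funM; first exact: measurable_fst.
exact: measurable_snd.
Qed.

(** Independence says that the joint law of [Y] and [Z] agrees with the product of their laws on
    rectangles, hence everywhere; the product rule for means is then Fubini's theorem. *)
Let prodE (h : R * R -> \bar R) :
  (\int[muY \x muZ]_p h p = \int[distribution P pairYZ]_p h p)%E.
Proof.
apply: eq_measure_integral => A mA _.
exact: product_measure_unique.
Qed.

Let mEFin : measurable_fun setT (EFin \o (@id R)).
Proof. exact/measurable_EFinP. Qed.

Let intY : muY.-integrable setT (EFin \o id).
Proof.
have /integrableP[_ h] := iY; apply/integrableP; split => //.
rewrite ge0_integral_distribution//; exact: measurableT_comp.
Qed.

Let intZ : muZ.-integrable setT (EFin \o id).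
Proof.
have /integrableP[_ h] := iZ; apply/integrableP; split => //.
rewrite ge0_integral_distribution//; exact: measurableT_comp.
Qed.

Let intf : (muY \x muZ)%E.-integrable setT f.
Proof.
apply/integrable12ltyP => //.
under eq_integral => x _.
  under eq_integral do rewrite /f /= normrM EFinM.
  rewrite ge0_integralZl//; last first.
    by apply/measurable_EFinP; exact: normr_measurable.
  over.
have /integrableP[_ hZ] := intZ; have /integrableP[_ hY] := intY.
have hZ' : (\int[muZ]_x `|x|%:E)%E \is a fin_num.
  by rewrite ge0_fin_numE//; apply: integral_ge0 => x _; rewrite lee_fin.
rewrite /=; under eq_integral do rewrite muleC.
rewrite ge0_integralZl//=.
- by rewrite lte_mul_pinfty// ?integral_ge0.
- by apply/measurable_EFinP; exact: normr_measurable.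
- by apply: integral_ge0 => x _; rewrite lee_fin.
Qed.

Lemma integrable_indepM : P.-integrable setT (EFin \o (Y \* Z)).
Proof.
have /integrableP[_ h] := intf.
apply/integrableP; split.
  by apply/measurable_EFinP; exact: measurable_funM.
move: h; rewrite prodE ge0_integral_distribution//; exact: measurableT_comp.
Qed.

Lemma expectation_indepM :
  (\int[P]_w (Y w * Z w) = (\int[P]_w Y w) * (\int[P]_w Z w))%R.
Proof.
rewrite /Rintegral -fineM; [|exact: integrable_fin_num..]; congr fine.
transitivity (\int[distribution P pairYZ]_p f p)%E.
  by rewrite integral_distribution//; exact: integrable_indepM.
rewrite -prodE -integral12_prod_meas1//.
have -> : (\int[P]_w (Y w)%:E = \int[muY]_y y%:E)%E.
  by rewrite integral_distribution//; apply/measurable_EFinP.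
have -> : (\int[P]_w (Z w)%:E = \int[muZ]_y y%:E)%E.
  by rewrite integral_distribution//; apply/measurable_EFinP.
under eq_integral => x _.
  rewrite /fubini_F /f /=; under eq_integral do rewrite EFinM.
  rewrite integralZl//; over.
rewrite /= -(fineK (integrable_fin_num _ intZ))//.
by rewrite integralZr.
Qed.

End indep_expectation.

(** * Moments of Gaussian increments *)

Section expectation_toolbox.
Context (disp : measure_display) (T : measurableType disp) (R : realType)
  (P : probability T R).
Implicit Types f g : T -> R.

Definition finite_mean f := P.-integrable setT (EFin \o f).

Lemma finite_mean_cst (c : R) : finite_mean (fun=> c).
Proof. exact: finite_measure_integrable_cst. Qed.

Lemma finite_meanD f g :
  finite_mean f -> finite_mean g -> finite_mean (fun w => f w + g w).
Proof.
by move=> If Ig; apply: eq_integrable (integrableD measurableT If Ig).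
Qed.

Lemma finite_meanZ (c : R) f : finite_mean f -> finite_mean (fun w => c * f w).
Proof. by move=> If; apply: eq_integrable (integrableZl measurableT c If). Qed.

Lemma finite_meanN f : finite_mean f -> finite_mean (fun w => - f w).
Proof.
move=> /(finite_meanZ (-1)); congr finite_mean.
by apply/funext => w; rewrite mulN1r.
Qed.

Lemma finite_meanB f g :
  finite_mean f -> finite_mean g -> finite_mean (fun w => f w - g w).
Proof. by move=> If /finite_meanN; exact: finite_meanD. Qed.

Lemma finite_mean_sum I (s : seq I) (Q : pred I) (f : I -> T -> R) :
  (forall i, Q i -> finite_mean (f i)) ->
  finite_mean (fun w => \sum_(i <- s | Q i) f i w).
Proof.
move=> If; elim: s => [|i s IH].
  rewrite (_ : (fun w => _) = (fun=> 0)); first exact: finite_mean_cst.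
  by apply/funext => w; rewrite big_nil.
case: (boolP (Q i)) => Qi.
  rewrite (_ : (fun w => _) =
      (fun w => f i w + \sum_(j <- s | Q j) f j w)); last first.
    by apply/funext => w; rewrite big_cons Qi.
  by apply: finite_meanD => //; exact: If.
rewrite (_ : (fun w => _) = (fun w => \sum_(j <- s | Q j) f j w))//.
by apply/funext => w; rewrite big_cons (negbTE Qi).
Qed.

Lemma finite_mean_le f g : measurable_fun setT f -> finite_mean g ->
  (forall w, `|f w| <= g w) -> finite_mean f.
Proof.
move=> mf Ig fg; apply: le_integrable Ig => //.
  exact/measurable_EFinP.
by move=> w _ /=; rewrite lee_fin (le_trans (fg w))// ler_norm.
Qed.

Lemma finite_mean_norm f : finite_mean f -> finite_mean (fun w => `|f w|).
Proof. exact: integrable_norm. Qed.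

Lemma finite_mean_bounded f (c : R) : measurable_fun setT f ->
  (forall w, `|f w| <= c) -> finite_mean f.
Proof. by move=> mf; apply: finite_mean_le => //; exact: finite_mean_cst. Qed.

Definition mean f : R := \int[P]_w f w.

Lemma meanE f : finite_mean f -> (\int[P]_w (f w)%:E = (mean f)%:E)%E.
Proof. by move=> If; rewrite /mean /Rintegral fineK//; exact: integrable_fin_num. Qed.

Lemma mean_cst (c : R) : mean (fun=> c) = c.
Proof.
rewrite /mean Rintegral_cst//.
by rewrite [X in fine X](@probability_setT _ _ _ P) mulr1.
Qed.

Lemma meanD f g : finite_mean f -> finite_mean g ->
  mean (fun w => f w + g w) = mean f + mean g.
Proof. exact: RintegralD. Qed.

Lemma meanB f g : finite_mean f -> finite_mean g ->
  mean (fun w => f w - g w) = mean f - mean g.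
Proof. exact: RintegralB. Qed.

Lemma meanZ (c : R) f : finite_mean f -> mean (fun w => c * f w) = c * mean f.
Proof. by move=> If; exact: RintegralZl. Qed.

Lemma mean_sum I (s : seq I) (Q : pred I) (f : I -> T -> R) :
  (forall i, Q i -> finite_mean (f i)) ->
  mean (fun w => \sum_(i <- s | Q i) f i w) = \sum_(i <- s | Q i) mean (f i).
Proof.
move=> If; elim: s => [|i s IH].
  rewrite (_ : (fun w => _) = (fun=> 0)) ?mean_cst ?big_nil//.
  by apply/funext => w; rewrite big_nil.
case: (boolP (Q i)) => Qi.
  rewrite (_ : (fun w => _) =
      (fun w => f i w + \sum_(j <- s | Q j) f j w)); last first.
    by apply/funext => w; rewrite big_cons Qi.
  rewrite meanD ?IH ?big_cons ?Qi//; first exact: If.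
  exact: finite_mean_sum.
rewrite (_ : (fun w => _) = (fun w => \sum_(j <- s | Q j) f j w)).
  by rewrite IH big_cons (negbTE Qi).
by apply/funext => w; rewrite big_cons (negbTE Qi).
Qed.

Lemma le_mean f g : finite_mean f -> finite_mean g ->
  (forall w, f w <= g w) -> mean f <= mean g.
Proof. by move=> If Ig fg; apply: le_Rintegral. Qed.

Lemma norm_mean_le f g : finite_mean f -> finite_mean g ->
  (forall w, `|f w| <= g w) -> `|mean f| <= mean g.
Proof.
move=> If Ig fg; apply: le_trans (le_normr_Rintegral _ If) _ => //.
by apply: le_mean => //; exact: finite_mean_norm.
Qed.

End expectation_toolbox.

Section expR_taylor.
Context {R : realType}.
Implicit Types v : R.

(** The tail of the series from degree 3 on is compared term by term with [|v| ^+ 3] times the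
    exponential series of |v|, using (i + 3)! >= i!. *)
Lemma expR_taylor2 v : `|expR v - 1 - v - v ^+ 2 / 2| <= `|v| ^+ 3 * expR `|v|.
Proof.
pose S u n := series (exp_coeff (u : R)) n.
have cvgS u : S u n @[n --> \oo] --> expR u by exact: is_cvg_series_exp_coeff.
have c1 : `|S v n.+3 - 1 - v - v ^+ 2 / 2| @[n --> \oo] -->
          `|expR v - 1 - v - v ^+ 2 / 2|.
  apply: cvg_norm; apply: cvgB; last exact: cvg_cst.
  apply: cvgB; last exact: cvg_cst.
  apply: cvgB; last exact: cvg_cst.
  rewrite (_ : (fun n => S v n.+3) = (fun n => S v (n + 3)%N)); last first.
    by apply/funext => n; rewrite addn3.
  by rewrite cvg_shiftn.
have SE u n : S u n = \sum_(0 <= k < n) u ^+ k / k`!%:R by [].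
have Sle n : S `|v| n <= expR `|v|.
  apply: nondecreasing_cvgn_le; last exact: cvgS.
  by apply/nondecreasing_series => k _ _; exact: exp_coeff_ge0.
apply: (ler_cvg_to c1 (cvg_cst _)); near=> n.
rewrite SE !big_nat_recl// /= expr0 fact0 divr1 expr1 divr1.
rewrite [X in `|X|](_ : _ = \sum_(0 <= i < n) v ^+ i.+3 / i.+3`!%:R); last first.
  by rewrite (_ : 2`!%:R = 2 :> R)//; ring.
apply: (le_trans (ler_norm_sum _ _ _)).
apply: (@le_trans _ _ (`|v| ^+ 3 * S `|v| n)); last by rewrite ler_wpM2l.
rewrite SE big_distrr /=; apply: ler_sum => i _.
rewrite normrM normrX normfV [`|_%:R|]ger0_norm// mulrA -exprD add3n.
by rewrite ler_wpM2l// lef_pV2 ?posrE ?ltr0n ?fact_gt0// ler_nat leq_fact// -addn3 leq_addr.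
Unshelve. all: by end_near. Qed.

(** Unlike exp |v|, the right-hand side has a Gaussian mean that can be read off from the moment
    generating function. *)
Lemma expR_norm_le v : expR `|v| <= expR v + expR (- v).
Proof.
have [v0|v0] := leP 0 v.
  by rewrite ger0_norm// lerDl expR_ge0.
by rewrite ltr0_norm// lerDr expR_ge0.
Qed.

Lemma exprn_norm_le_expR v n :
  `|v| ^+ n <= n`!%:R * (expR v + expR (- v)).
Proof.
apply: (@le_trans _ _ (n`!%:R * expR `|v|)); last first.
  by rewrite ler_wpM2l// expR_norm_le.
rewrite -ler_pdivrMl ?ltr0n ?fact_gt0// mulrC.
case: n => [|n]; first by rewrite expr0 fact0 divr1 -expR0 ler_expR.
by apply: le_trans (expR_ge1Dxn n (normr_ge0 v)); rewrite lerDr.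
Qed.

End expR_taylor.

Section normal_integral.
Context {R : realType}.
Local Notation mu := lebesgue_measure.

(** The Radon-Nikodym derivative of the normal law and its density have the same integral over every
    measurable set, so they agree almost everywhere. *)
Lemma ge0_integral_normal_prob (m s : R) (f : R -> \bar R) :
  s != 0 -> (forall x, (0 <= f x)%E) -> measurable_fun setT f ->
  (\int[normal_prob m s]_x f x = \int[mu]_x (f x * (normal_pdf m s x)%:E))%E.
Proof.
move=> s0 f0 mf.
have dom := normal_prob_dominates m s.
rewrite -(Radon_Nikodym_SigmaFinite.change_of_variables dom f0)//.
have If := Radon_Nikodym_SigmaFinite.f_integrable dom.
have mp : measurable_fun setT (fun x => (normal_pdf m s x)%:E : \bar R).
  by apply/measurable_EFinP; exact: measurable_normal_pdf.
apply: ge0_ae_eq_integral => //.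
- by apply: emeasurable_funM => //; exact: (measurable_int mu).
- exact: emeasurable_funM.
- by move=> x _; rewrite mule_ge0// Radon_Nikodym_SigmaFinite.f_ge0.
- by move=> x _; rewrite mule_ge0// lee_fin normal_pdf_ge0.
- apply: ae_eqe_mul2l; apply: integral_ae_eq => //.
  by move=> E _ mE; rewrite -Radon_Nikodym_SigmaFinite.f_integral.
Qed.

Lemma normal_prob_mgf (s u : R) : s != 0 ->
  (\int[normal_prob 0 s]_x (expR (u * x))%:E = (expR (u ^+ 2 * s ^+ 2 / 2))%:E)%E.
Proof.
move=> s0; rewrite ge0_integral_normal_prob//; last first.
  by apply/measurable_EFinP; apply: measurableT_comp => //; exact: measurable_funM.
(* Completing the square: tilting the centred density by exp(u x) moves its mean to u s^2. *)
have E x : expR (u * x) * normal_pdf 0 s x =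
    expR (u ^+ 2 * s ^+ 2 / 2) * normal_pdf (u * s ^+ 2) s x.
  rewrite !normal_pdfE// /normal_fun mulrCA [RHS]mulrCA -!expRD.
  congr (_ * expR _).
  by field; rewrite s0.
under eq_integral do rewrite -EFinM E EFinM.
rewrite ge0_integralZl//=.
- by rewrite integral_normal_pdf mule1.
- by apply/measurable_EFinP; exact: measurable_normal_pdf.
- by move=> x _; rewrite lee_fin normal_pdf_ge0.
Qed.

End normal_integral.

Lemma norm_le_linear_eq0 (R : realFieldType) (b C : R) :
  (forall t, 0 < t <= 1 -> `|b| <= C * t) -> b = 0.
Proof.
move=> h; apply/eqP; rewrite -normr_eq0 eq_le normr_ge0 andbT.
apply/ler_addgt0Pl => e e0; rewrite addr0.
pose t := Num.min 1 (e / (`|C| + 1)).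
have C1 : 0 < `|C| + 1 by rewrite ltr_wpDl.
have t0 : 0 < t by rewrite lt_min ltr01 divr_gt0.
apply: (le_trans (h t _)); first by rewrite t0 ge_min lexx.
apply: (@le_trans _ _ ((`|C| + 1) * t)).
  by rewrite ler_pM2r// (le_trans (ler_norm C))// lerDl.
by rewrite mulrC -ler_pdivlMr// ge_min lexx orbT.
Qed.

Section gaussian_moments.
Context (disp : measure_display) (T : measurableType disp) (R : realType)
  (P : probability T R) (xi : T -> R) (s : R).
Hypotheses (mxi : measurable_fun setT xi) (s0 : 0 < s)
  (hxi : forall A : set R, measurable A -> pushforward P xi A = normal_prob 0 s A).

Let xiR : T -> measurableTypeR R := xi.
HB.instance Definition _ := isMeasurableFun.Build _ _ T (measurableTypeR R) xiR mxi.

Let mu_xi : probability (measurableTypeR R) R := distribution P xiR.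

Lemma gaussian_mgf (u : R) :
  (\int[P]_w (expR (u * xi w))%:E = (expR (u ^+ 2 * s ^+ 2 / 2))%:E)%E.
Proof.
rewrite -normal_prob_mgf ?gt_eqF//.
pose f (x : R) := (expR (u * x))%:E : \bar R.
have mf : measurable_fun setT f.
  by apply/measurable_EFinP; apply: measurableT_comp => //; exact: measurable_funM.
transitivity (\int[mu_xi]_x f x)%E.
  by rewrite ge0_integral_distribution// => x; rewrite lee_fin expR_ge0.
by apply: eq_measure_integral => A mA _; exact: hxi.
Qed.

Lemma finite_mean_gaussian_mgf (u : R) : finite_mean P (fun w => expR (u * xi w)).
Proof.
apply/integrableP; split.
  by apply/measurable_EFinP; do 2 apply: measurableT_comp => //.
under eq_integral => w _ do rewrite /= ger0_norm ?expR_ge0//.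
by rewrite gaussian_mgf ltry.
Qed.

Lemma mean_gaussian_mgf (u : R) :
  mean P (fun w => expR (u * xi w)) = expR (u ^+ 2 * s ^+ 2 / 2).
Proof. by rewrite /mean /Rintegral gaussian_mgf. Qed.

Let cosh2 (u : R) w := expR (u * xi w) + expR (- u * xi w).

Let finite_mean_cosh2 u : finite_mean P (cosh2 u).
Proof. by rewrite /cosh2; apply: finite_meanD; exact: finite_mean_gaussian_mgf. Qed.

Let mean_cosh2 u : mean P (cosh2 u) = 2 * expR (u ^+ 2 * s ^+ 2 / 2).
Proof.
rewrite /cosh2 meanD; [|exact: finite_mean_gaussian_mgf..].
by rewrite !mean_gaussian_mgf sqrrN mulr2n mulrDl !mul1r.
Qed.

Let pow_le n w : `|xi w ^+ n| <= (s ^+ n * n`!%:R) * cosh2 s^-1 w.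
Proof.
have := exprn_norm_le_expR (s^-1 * xi w) n.
rewrite normrM exprMn normfV (gtr0_norm s0) exprVn -mulNr => h.
by rewrite normrX -mulrA -ler_pdivrMl ?exprn_gt0.
Qed.

Lemma finite_mean_gaussian_pow n : finite_mean P (fun w => xi w ^+ n).
Proof.
apply: (finite_mean_le _ _ (pow_le n)); first exact: measurable_funX.
exact: finite_meanZ.
Qed.

(** The moment generating function is used at 1/s and -1/s, so the factor s^n comes out with a
    constant free of s; moments of increments divided by their standard deviation are thus bounded
    uniformly in the mesh. *)
Lemma mean_gaussian_pow n :
  mean P (fun w => `|xi w| ^+ n) <= 2 * expR 2^-1 * n`!%:R * s ^+ n.
Proof.
apply: (@le_trans _ _ (mean P (fun w => (s ^+ n * n`!%:R) * cosh2 s^-1 w))).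
  apply: le_mean.
  - rewrite (_ : (fun w => _) = (fun w => `|xi w ^+ n|)).
      exact/finite_mean_norm/finite_mean_gaussian_pow.
    by apply/funext => w; rewrite normrX.
  - exact: finite_meanZ.
  - by move=> w; rewrite -normrX.
rewrite meanZ// mean_cosh2 exprVn mulVf ?expf_neq0 ?gt_eqF// mul1r.
by rewrite le_eqVlt; apply/orP; left; apply/eqP; ring.
Qed.

(* The first two moments are read off by comparing, at [t = 0], the second-order
   expansions of the two sides of [mean (expR (t / s * xi)) = expR (t ^+ 2 / 2)]. *)
Let taylor_mean (t : R) : `|t| <= 1 ->
  `|expR (t ^+ 2 / 2) - 1 - t * (mean P xi / s)
    - t ^+ 2 * (mean P (fun w => xi w ^+ 2) / (2 * s ^+ 2))|
  <= (12 * expR 2) * `|t| ^+ 3.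
Proof.
move=> t1.
have s1 := finite_mean_gaussian_pow 1; have s2 := finite_mean_gaussian_pow 2.
have sz : s != 0 by rewrite gt_eqF.
pose f w := (expR (t / s * xi w) - 1 - (t / s) * xi w ^+ 1)
   - (t ^+ 2 / (2 * s ^+ 2)) * xi w ^+ 2.
have sf1 : finite_mean P (fun w => expR (t / s * xi w) - 1).
  by apply: finite_meanB; [exact: finite_mean_gaussian_mgf|exact: finite_mean_cst].
have sf2 : finite_mean P (fun w => expR (t / s * xi w) - 1 - (t / s) * xi w ^+ 1).
  by apply: finite_meanB => //; exact: finite_meanZ.
have sf : finite_mean P f by apply: finite_meanB => //; exact: finite_meanZ.
have -> : expR (t ^+ 2 / 2) - 1 - t * (mean P xi / s)
    - t ^+ 2 * (mean P (fun w => xi w ^+ 2) / (2 * s ^+ 2)) = mean P f.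
  rewrite /f meanB//; last exact: finite_meanZ.
  rewrite meanB//; last exact: finite_meanZ.
  rewrite meanB; [|exact: finite_mean_gaussian_mgf|exact: finite_mean_cst].
  rewrite mean_cst mean_gaussian_mgf !meanZ//.
  have -> : mean P (fun w => xi w ^+ 1) = mean P xi.
    by congr mean; apply/funext => w; rewrite expr1.
  have -> : (t / s) ^+ 2 * s ^+ 2 / 2 = t ^+ 2 / 2 by field.
  by field.
(* With v = xi / s, the cubic remainder is dominated through |v|^3 <= 6 exp |v| and exp |t v| <= exp
   |v|, hence by 6 |t|^3 (exp(2v) + exp(-2v)), whose mean is 12 exp(2) |t|^3. *)
have -> : 12 * expR 2 * `|t| ^+ 3 =
    mean P (fun w => (6 * `|t| ^+ 3) * cosh2 (2 / s) w).
  rewrite meanZ// mean_cosh2 (_ : (2 / s) ^+ 2 * s ^+ 2 / 2 = 2); last by field.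
  by ring.
apply: norm_mean_le => //; first exact: finite_meanZ.
move=> w; rewrite /f /cosh2.
have := expR_taylor2 (t / s * xi w).
have -> : (t / s * xi w) ^+ 2 / 2 = t ^+ 2 / (2 * s ^+ 2) * xi w ^+ 2 by field.
rewrite expr1 => /le_trans; apply.
set v := xi w / s.
have -> : t / s * xi w = t * v by rewrite /v; ring.
have -> : 2 / s * xi w = v + v by rewrite /v; ring.
have -> : - (2 / s) * xi w = - (v + v) by rewrite /v; ring.
have v3 : `|v| ^+ 3 <= 6 * expR `|v|.
  have := expR_ge1Dxn 2 (normr_ge0 v); rewrite (_ : 3`!%:R = 6 :> R)// => h.
  by rewrite -ler_pdivrMl// mulrC; apply: le_trans h; rewrite lerDr.
have tv : expR `|t * v| <= expR `|v|.
  by rewrite ler_expR normrM ler_piMl.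
have vv : expR `|v| * expR `|v| <= expR (v + v) + expR (- (v + v)).
  by rewrite -expRD -mulr2n -normrMn mulr2n; exact: expR_norm_le.
rewrite [leLHS](_ : _ = `|t| ^+ 3 * (`|v| ^+ 3 * expR `|t * v|)); last first.
  by rewrite [X in X ^+ 3]normrM exprMn mulrA.
rewrite [leRHS](_ : _ = `|t| ^+ 3 * (6 * (expR (v + v) + expR (- (v + v))))); last first.
  by ring.
rewrite ler_wpM2l ?exprn_ge0//.
apply: (@le_trans _ _ (6 * expR `|v| * expR `|v|)).
  by apply: ler_pM; rewrite ?exprn_ge0 ?expR_ge0.
by rewrite -mulrA ler_wpM2l.
Qed.

(** Comparing the bounds at t and -t separates the odd part from the even part; dividing by t or t^2
    leaves a bound linear in t. *)
Let coef_le (a b C : R) :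
  (forall t, `|t| <= 1 -> `|t * a + t ^+ 2 * b| <= C * `|t| ^+ 3) ->
  a = 0 /\ b = 0.
Proof.
move=> h.
have h2 t : 0 < t <= 1 -> `|t * a| <= C * t ^+ 3 /\ `|t ^+ 2 * b| <= C * t ^+ 3.
  move=> /andP[t0 t1].
  have := h t; have := h (- t); rewrite normrN gtr0_norm// sqrrN mulNr.
  move=> /(_ t1); rewrite ler_norml => /andP[h1 h1'].
  move=> /(_ t1); rewrite ler_norml => /andP[h3 h3'].
  by split; rewrite ler_norml; apply/andP; split; lra.
split; apply: (@norm_le_linear_eq0 _ _ C) => t /[dup] /h2[ha hb] /andP[t0 t1].
- rewrite normrM gtr0_norm// in ha.
  have : `|a| <= C * t ^+ 2.
    rewrite -(ler_pM2l t0); apply: (le_trans ha).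
    by rewrite le_eqVlt; apply/orP; left; apply/eqP; ring.
  have C0 : 0 <= C.
    have := le_trans (normr_ge0 _) (h 1 _); rewrite normr1 expr1n mulr1; exact.
  by move=> /le_trans; apply; rewrite ler_wpM2l// expr2 ler_piMr// ltW.
- have t20 : 0 < t ^+ 2 by exact: exprn_gt0.
  rewrite normrM (gtr0_norm t20) in hb.
  rewrite -(ler_pM2l t20); apply: (le_trans hb).
  by rewrite le_eqVlt; apply/orP; left; apply/eqP; ring.
Qed.

Lemma gaussian_mean_var :
  mean P xi = 0 /\ mean P (fun w => xi w ^+ 2) = s ^+ 2.
Proof.
have sz : s != 0 by rewrite gt_eqF.
set m1 := mean P xi; set m2 := mean P _.
suff [h1 h2] : m1 / s = 0 /\ m2 / (2 * s ^+ 2) - 2^-1 = 0.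
  split; first by have := congr1 ( *%R^~ s) h1; rewrite divfK// mul0r.
  have := congr1 ( *%R^~ (2 * s ^+ 2)) h2.
  rewrite mul0r mulrBl divfK ?mulf_neq0 ?expf_neq0// => /eqP.
  by rewrite mulrA mulVf// mul1r subr_eq0 => /eqP.
apply: (@coef_le _ _ (12 * expR 2 + expR 2^-1)) => t t1.
have t2 : 0 <= t ^+ 2 / 2 by rewrite divr_ge0// sqr_ge0.
have t21 : t ^+ 2 <= 1 by rewrite -real_normK ?num_real// exprn_ile1.
have := taylor_mean t1; rewrite -/m1 -/m2.
have := expR_taylor2 (t ^+ 2 / 2); rewrite (ger0_norm t2) => hA hB.
set E := expR (t ^+ 2 / 2) in hA hB *.
(* The remaining terms are of order t^4 and t^6, which |t| <= 1 reduces to |t|^3. *)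
have hC : `|E - 1 - t ^+ 2 / 2| <= expR 2^-1 * `|t| ^+ 3.
  have tt : t ^+ 2 = `|t| ^+ 2 by rewrite real_normK ?num_real.
  have E1 : E <= expR 2^-1 by rewrite /E ler_expR ler_pdivrMr// mulVf.
  have e1 : 1 <= expR 2^-1 :> R by rewrite -expR0 ler_expR invr_ge0.
  have E0 : 0 <= E by exact: expR_ge0.
  move: hA; rewrite tt; move: t1; move: (`|t|) (normr_ge0 t) => u u0 u1 hA.
  have u3 : 0 <= u ^+ 3 by exact: exprn_ge0.
  have h4 : u ^+ 2 / 2 * (u ^+ 2 / 2) / 2 <= u ^+ 3 / 8.
    rewrite (_ : _ / 2 = u ^+ 3 / 8 * u); last by field.
    by rewrite ler_piMr// divr_ge0.
  have h6 : (u ^+ 2 / 2) ^+ 3 * E <= u ^+ 3 / 8 * expR 2^-1.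
    rewrite (_ : (u ^+ 2 / 2) ^+ 3 * E = u ^+ 3 / 8 * (u ^+ 3 * E)); last by field.
    rewrite ler_wpM2l ?divr_ge0//; apply: le_trans E1.
    by rewrite ler_piMl// exprn_ile1.
  have h8 : u ^+ 3 <= u ^+ 3 * expR 2^-1 by rewrite ler_peMr.
  rewrite (mulrC (expR _)).
  move: hA; rewrite !ler_norml => /andP[hA1 hA2].
  have h0 : 0 <= u ^+ 2 / 2 * (u ^+ 2 / 2) / 2.
    by rewrite divr_ge0// mulr_ge0// divr_ge0// sqr_ge0.
  rewrite [(_ / 2) ^+ 2]expr2 in hA1 hA2.
  set q1 := u ^+ 2 / 2 * _ / 2 in hA1 hA2 h4 h0.
  set q2 := _ ^+ 3 * E in hA1 hA2 h6; set q3 := u ^+ 3 * expR _ in h8 *.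
  have h6' : q2 <= q3 / 8.
    apply: (le_trans h6); rewrite /q3 le_eqVlt; apply/orP; left.
    by apply/eqP; ring.
  have q20 : 0 <= q3 by apply: le_trans h8.
  by apply/andP; split; lra.
have -> : t * (m1 / s) + t ^+ 2 * (m2 / (2 * s ^+ 2) - 2^-1) =
  (E - 1 - t ^+ 2 / 2) - (E - 1 - t * (m1 / s) - t ^+ 2 * (m2 / (2 * s ^+ 2))).
  by ring.
apply: (le_trans (ler_normB _ _)).
by rewrite [leRHS]mulrDl [leRHS]addrC; apply: lerD.
Qed.

End gaussian_moments.

(** * One step of the scheme *)

Section test_function.
Context {R : realType}.
Variables (alpha beta mu : R).
Hypotheses (alpha0 : 0 <= alpha) (beta0 : 0 <= beta) (mu0 : 0 <= mu).

(** The function g of the overview; [lyap1] and [lyap2] are its first two derivatives. *)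
Definition lyap (r : R) := alpha * expR (mu * r) + beta * r.
Definition lyap1 (r : R) := alpha * mu * expR (mu * r) + beta.
Definition lyap2 (r : R) := alpha * mu ^+ 2 * expR (mu * r).

Lemma lyap_le r r' : r <= r' -> lyap r <= lyap r'.
Proof.
by move=> rr'; apply: lerD; apply: ler_wpM2l => //; rewrite ler_expR ler_wpM2l.
Qed.

Lemma lyap_ge0 r : 0 <= r -> 0 <= lyap r.
Proof. by move=> r0; rewrite addr_ge0// mulr_ge0// expR_ge0. Qed.

Lemma lyap1_ge0 r : 0 <= lyap1 r.
Proof. by rewrite addr_ge0// !mulr_ge0// expR_ge0. Qed.

Lemma lyap2_ge0 r : 0 <= lyap2 r.
Proof. by rewrite !mulr_ge0 ?exprn_ge0// expR_ge0. Qed.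

Lemma lyap1_le r r' : r <= r' -> lyap1 r <= lyap1 r'.
Proof.
by move=> rr'; rewrite lerD2r ler_wpM2l ?mulr_ge0// ler_expR ler_wpM2l.
Qed.

Lemma lyap2_le r r' : r <= r' -> lyap2 r <= lyap2 r'.
Proof.
by move=> rr'; rewrite ler_wpM2l ?mulr_ge0 ?exprn_ge0// ler_expR ler_wpM2l.
Qed.

(** Capping keeps the cubic error. If r' <= M this is Taylor's formula for the exponential, the
    linear part being exact. If r' > M then r' - r >= M - l2, and each term, being at most a
    constant times a power of r' - r of degree at most 2, is absorbed by the cube: this is [C2]. *)
Lemma lyap_taylor (l2 M : R) : 0 <= l2 -> l2 < M -> exists C, 0 <= C /\
  forall r r', 0 <= r -> r <= l2 -> 0 <= r' ->
  `|lyap (Num.min r' M) - lyap r - lyap1 r * (r' - r)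
      - lyap2 r * (r' - r) ^+ 2 / 2| <= C * `|r' - r| ^+ 3.
Proof.
move=> l20 lM; pose dl := M - l2.
have dl0 : 0 < dl by rewrite subr_gt0.
have M0 : 0 <= M by apply: le_trans (ltW lM).
pose C1 := alpha * expR (mu * M) * (mu ^+ 3 * expR (mu * M)).
pose C2 := lyap M / dl ^+ 3 + lyap1 M / dl ^+ 2 + lyap2 M / dl.
have C10 : 0 <= C1 by rewrite !mulr_ge0 ?exprn_ge0 ?expR_ge0.
have a1 : 0 <= lyap M / dl ^+ 3.
  by rewrite divr_ge0 ?lyap_ge0 ?exprn_ge0// ltW.
have a2 : 0 <= lyap1 M / dl ^+ 2 by rewrite divr_ge0 ?lyap1_ge0 ?exprn_ge0// ltW.
have a3 : 0 <= lyap2 M / dl by rewrite divr_ge0 ?lyap2_ge0// ltW.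
exists (C1 + C2); split; first by rewrite addr_ge0// !addr_ge0.
move=> r r' r0 rl r'0; set q := r' - r.
have q30 : 0 <= `|q| ^+ 3 by rewrite exprn_ge0.
have rM : r <= M by apply: le_trans rl (ltW lM).
rewrite [leRHS]mulrDl.
have [r'M|Mr'] := leP r' M.
  apply: (@le_trans _ _ (C1 * `|q| ^+ 3)); last by rewrite lerDl mulr_ge0// !addr_ge0.
  have -> : lyap r' - lyap r - lyap1 r * q - lyap2 r * q ^+ 2 / 2 =
    alpha * expR (mu * r) * (expR (mu * q) - 1 - mu * q - (mu * q) ^+ 2 / 2).
    have -> : expR (mu * q) = expR (mu * r') / expR (mu * r).
      by rewrite /q mulrBr expRB.
    rewrite /lyap /lyap1 /lyap2 /q; field.
    by rewrite gt_eqF// expR_gt0.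
  rewrite normrM ger0_norm ?mulr_ge0 ?expR_ge0//.
  apply: (le_trans (ler_wpM2l _ (expR_taylor2 _))).
    by rewrite mulr_ge0 ?expR_ge0.
  have qM : `|q| <= M.
    by rewrite ler_norml /q; apply/andP; split; lra.
  rewrite /C1 -[leRHS]mulrA; apply: ler_pM.
  - by rewrite mulr_ge0 ?expR_ge0.
  - by rewrite mulr_ge0 ?exprn_ge0 ?expR_ge0.
  - by rewrite ler_wpM2l// ler_expR ler_wpM2l.
  - rewrite normrM (ger0_norm mu0) exprMn mulrAC ler_wpM2r//.
    by rewrite ler_wpM2l ?exprn_ge0// ler_expR ler_wpM2l.
apply: (@le_trans _ _ (C2 * `|q| ^+ 3)); last by rewrite lerDr mulr_ge0.
have qdl : dl <= q by rewrite /q /dl; lra.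
have q0 : 0 < q by apply: lt_le_trans qdl.
rewrite (gtr0_norm q0).
have q0' := ltW q0; have dl0' := ltW dl0.
have dq n : dl ^+ n <= q ^+ n by rewrite lerXn2r ?nnegrE.
have dqn n : 0 < dl ^+ n by exact: exprn_gt0.
have h1 : lyap M <= lyap M / dl ^+ 3 * q ^+ 3.
  by rewrite mulrAC -mulrA ler_peMr ?lyap_ge0// ler_pdivlMr// mul1r.
have h2 : lyap1 M * q <= lyap1 M / dl ^+ 2 * q ^+ 3.
  rewrite -mulrA ler_wpM2l ?lyap1_ge0// mulrC ler_pdivlMr//.
  by rewrite [leRHS]exprS ler_wpM2l.
have h3 : lyap2 M * q ^+ 2 <= lyap2 M / dl * q ^+ 3.
  rewrite -mulrA ler_wpM2l ?lyap2_ge0// mulrC ler_pdivlMr//.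
  by rewrite [leRHS]exprSr ler_wpM2l// exprn_ge0.
have := lyap_le rM; have := lyap_ge0 r0.
have := lyap1_le rM; have := lyap1_ge0 r.
have := lyap2_le rM; have := lyap2_ge0 r => g20 g2M g10 g1M g0 gM.
have b1 : lyap1 r * q <= lyap1 M * q by rewrite ler_wpM2r// ltW.
have b10 : 0 <= lyap1 r * q by rewrite mulr_ge0// ltW.
have q20 : 0 <= q ^+ 2 by rewrite exprn_ge0// ltW.
have b2 : lyap2 r * q ^+ 2 <= lyap2 M * q ^+ 2 by rewrite ler_wpM2r.
have b20 : 0 <= lyap2 r * q ^+ 2 by rewrite mulr_ge0.
have -> : C2 * q ^+ 3 = lyap M / dl ^+ 3 * q ^+ 3 + lyap1 M / dl ^+ 2 * q ^+ 3
    + lyap2 M / dl * q ^+ 3 by rewrite /C2; ring.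
move: (lyap M / _ * _) (lyap1 M / _ * _) (lyap2 M / _ * _) h1 h2 h3.
by move=> c1 c2 c3 h1 h2 h3; rewrite ler_norml; apply/andP; split; lra.
Qed.

End test_function.

Section one_step.
Context {R : realType}.
Variable d : nat.
Implicit Types z : 'I_d -> R.

Definition sqn z := \sum_i z i ^+ 2.
Definition dotp z z' := \sum_i z i * z' i.

Lemma sqn_ge0 z : 0 <= sqn z.
Proof. by apply: sumr_ge0 => i _; exact: sqr_ge0. Qed.

Lemma coord_le_sqn z i : z i ^+ 2 <= sqn z.
Proof.
by rewrite /sqn (bigD1 i)//= lerDl; apply: sumr_ge0 => j _; exact: sqr_ge0.
Qed.

Lemma sqnD z z' : sqn (fun i => z i + z' i) = sqn z + 2 * dotp z z' + sqn z'.
Proof.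
rewrite /sqn /dotp big_distrr /= -!big_split /=; apply: eq_bigr => i _.
by ring.
Qed.

Lemma dotp_norm_le z z' (a b : R) : 0 <= a ->
  (forall i, `|z i| <= a) -> (forall i, `|z' i| <= b) ->
  `|dotp z z'| <= d%:R * (a * b).
Proof.
move=> a0 za z'b; apply: le_trans (ler_norm_sum _ _ _) _.
apply: (@le_trans _ _ (\sum_(i < d) (a * b))).
  by apply: ler_sum => i _; rewrite normrM ler_pM.
by rewrite sumr_const card_ord mulr_natl.
Qed.

(** The witness is the maximum of 1 and the entries. It gives one bound for all coordinates of an
    increment, at the price of a sum of powers whose mean is known. *)
Lemma max_pow_le (s : seq R) n :
  exists y, [/\ 1 <= y, forall v, v \in s -> v <= y &
     (all (fun v => 0 <= v) s -> y ^+ n <= 1 + \sum_(v <- s) v ^+ n)].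
Proof.
elim: s => [|v s [y [y1 ys yn]]].
  by exists 1; split => // _; rewrite expr1n big_nil addr0.
exists (Num.max v y); split.
- by rewrite le_max y1 orbT.
- move=> v'; rewrite inE => /predU1P[->|/ys v'y]; rewrite le_max ?lexx//.
  by rewrite v'y orbT.
- move=> /= /andP[v0 s0]; rewrite big_cons addrCA.
  have yn' := yn s0.
  have [vy|vy] := leP v y.
    by rewrite (le_trans yn')// lerDr exprn_ge0.
  by rewrite lerDl (le_trans _ yn')// exprn_ge0// (le_trans _ y1).
Qed.

Variables (alpha beta mu : R).
Hypotheses (alpha0 : 0 <= alpha) (beta0 : 0 <= beta) (mu0 : 0 <= mu).
Variables (sigma theta : R).
Hypothesis sigma0 : 0 < sigma.

Local Notation g := (lyap alpha beta mu).
Local Notation g1 := (lyap1 alpha beta mu).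
Local Notation g2 := (lyap2 alpha mu).

Definition generator (r : R) :=
  g1 r * (sigma ^+ 2 * d%:R - 2 * theta * r) + 2 * sigma ^+ 2 * r * g2 r.

(** The noise terms up to second order in the expansion of g(|z + sigma xi|^2), minus their means
    for independent centred components of variance [h]. *)
Definition martingale_part (h : R) z (xi : 'I_d -> R) :=
  g1 (sqn z) * (2 * sigma * dotp z xi + sigma ^+ 2 * (sqn xi - d%:R * h))
  + 2 * sigma ^+ 2 * g2 (sqn z) * (dotp z xi ^+ 2 - h * sqn z).

Local Ltac nonneg := repeat match goal with
  | |- is_true (0 <= _ ^+ 2) => exact: sqr_ge0
  | |- is_true (0 <= _ ^+ _) => apply: exprn_ge0
  | |- is_true (0 <= _ + _) => apply: addr_ge0
  | |- is_true (0 <= _ * _) => apply: mulr_ge0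
  | |- _ => done
  end.

(* With [y >= 1] an upper bound for the [`|xi i| / a], every error term is at most
   a constant times [a ^+ 3 * y ^+ 6]; for [xi i] normal with standard deviation
   [a], the mean of the right-hand side is thus of order [a ^+ 3]. *)
Lemma one_step_taylor (l2 M c : R) : 0 <= l2 -> l2 < M -> 0 <= c ->
  exists K, 0 <= K /\ forall (a : R) z D (xi : 'I_d -> R),
    0 < a -> a <= 1 -> sqn z <= l2 -> (forall i, `|D i| <= c * a ^+ 2) ->
    `|g (Num.min (sqn (fun i => z i + (D i + sigma * xi i))) M) - g (sqn z)
      - a ^+ 2 * generator (sqn z) - martingale_part (a ^+ 2) z xi
      - 2 * g1 (sqn z) * dotp z (fun i => D i + theta * a ^+ 2 * z i)|
    <= K * (a ^+ 3 * (1 + \sum_i (`|xi i| / a) ^+ 6)).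
Proof.
move=> l20 lM c0.
have [C [C0 taylor]] := lyap_taylor alpha0 beta0 mu0 l20 lM.
pose n : R := d%:R; have n0 : 0 <= n by exact: ler0n.
(* Bounds every coordinate of a point of the ball: |z_i| <= max(1, z_i^2) <= 1 + l2. *)
pose K0 := 1 + l2.
have K00 : 0 <= K0 by rewrite addr_ge0.
pose K1 := 2 * (n * (K0 * c)) + n * (c + sigma) ^+ 2.
pose K2 := 2 * sigma * (n * K0) + K1.
have s0 : 0 <= sigma by exact: ltW.
have K10 : 0 <= K1 by rewrite /K1; nonneg.
have K20 : 0 <= K2 by rewrite /K2; nonneg.
have g1l0 : 0 <= g1 l2 by exact: lyap1_ge0.
have g2l0 : 0 <= g2 l2 by exact: lyap2_ge0.
pose KA := C * K2 ^+ 3.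
pose KB := g2 l2 * (K1 * (K1 + 4 * sigma * (n * K0))).
pose KC := g1 l2 * (2 * sigma * (n * c) + n * c ^+ 2).
have KA0 : 0 <= KA by rewrite /KA; nonneg.
have KB0 : 0 <= KB by rewrite /KB; nonneg.
have KC0 : 0 <= KC by rewrite /KC; nonneg.
exists (KA + KB + KC); split; first by nonneg.
move=> a z D xi a0 a1 zl Dc.
have a0' := ltW a0.
have [y [y1 yxi y6]] := max_pow_le [seq `|xi i| / a | i : 'I_d] 6.
have xiy i : `|xi i| <= a * y.
  by rewrite mulrC -ler_pdivrMr//; apply: yxi; apply: map_f; rewrite mem_enum.
have {yxi}y6 : y ^+ 6 <= 1 + \sum_i (`|xi i| / a) ^+ 6.
  have := y6; rewrite big_map big_enum /=; apply.
  by rewrite all_map; apply/allP => i _ /=; rewrite divr_ge0.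
apply: (@le_trans _ _ ((KA + KB + KC) * (a ^+ 3 * y ^+ 6))); last first.
  by rewrite ler_wpM2l ?addr_ge0// ler_wpM2l// exprn_ge0.
have y0 : 0 <= y by apply: le_trans y1.
have ay0 : 0 <= a * y by rewrite mulr_ge0.
have zK i : `|z i| <= K0.
  have h : `|z i| ^+ 2 <= l2.
    by rewrite real_normK ?num_real// (le_trans (coord_le_sqn z i)).
  have [zi1|zi1] := leP `|z i| 1; first by rewrite /K0; lra.
  have : `|z i| <= `|z i| ^+ 2 by rewrite expr2 ler_peMl// ltW.
  by rewrite /K0; lra.
have z0 := sqn_ge0 z.
pose r := sqn z.
(* The increment of the squared norm is [m + rho], where [m] is linear in the noise and of order
   [a], and [rho] is of order [a ^+ 2]. *)
pose rho := 2 * dotp z D + sqn (fun i => D i + sigma * xi i).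
pose m := 2 * sigma * dotp z xi.
pose r' := sqn (fun i => z i + (D i + sigma * xi i)).
have r'E : r' = r + (m + rho).
  rewrite /r' sqnD /m /rho addrA /r -!addrA; congr (_ + _).
  rewrite addrA; congr (_ + _).
  rewrite /dotp !mulr_sumr -big_split /=; apply: eq_bigr => i _; ring.
have a2y2 : 0 <= a ^+ 2 * y ^+ 2 by rewrite mulr_ge0 ?exprn_ge0.
have a2a : a ^+ 2 <= a * y.
  by rewrite expr2 ler_wpM2l// (le_trans a1).
have y2y : y <= y ^+ 2 by rewrite expr2 ler_peMl.
have y21 : 1 <= y ^+ 2 by rewrite (le_trans y1).
have zD : `|dotp z D| <= n * (K0 * c) * a ^+ 2.
  by rewrite -!mulrA; exact: dotp_norm_le.
have zxi : `|dotp z xi| <= n * K0 * (a * y).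
  by rewrite -mulrA; exact: dotp_norm_le.
have Dxi i : (D i + sigma * xi i) ^+ 2 <= (c + sigma) ^+ 2 * (a * y) ^+ 2.
  rewrite -exprMn -real_normK ?num_real// lerXn2r ?nnegrE ?mulr_ge0 ?addr_ge0//.
  apply: (le_trans (ler_normD _ _)); rewrite mulrDl lerD//.
    by apply: (le_trans (Dc i)); rewrite ler_wpM2l.
  by rewrite normrM (ger0_norm s0) ler_wpM2l.
have sD : sqn (fun i => D i + sigma * xi i) <= n * ((c + sigma) ^+ 2 * (a * y) ^+ 2).
  apply: (@le_trans _ _ (\sum_(i < d) ((c + sigma) ^+ 2 * (a * y) ^+ 2))).
    by apply: ler_sum => i _; exact: Dxi.
  by rewrite sumr_const card_ord mulr_natl.
have rhoK : `|rho| <= K1 * (a ^+ 2 * y ^+ 2).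
  apply: (le_trans (ler_normD _ _)).
  rewrite [X in _ + X]ger0_norm ?sqn_ge0// normrM (ger0_norm (ler0n _ 2)).
  have h : 2 * `|dotp z D| <= 2 * (n * (K0 * c)) * (a ^+ 2 * y ^+ 2).
    rewrite -mulrA ler_wpM2l//; apply: (le_trans zD).
    by rewrite ler_wpM2l ?mulr_ge0// ler_peMr// exprn_ge0.
  rewrite /K1 [leRHS]mulrDl; apply: lerD => //.
  apply: (le_trans sD).
  by rewrite le_eqVlt; apply/orP; left; apply/eqP; ring.
have mK : `|m| <= 2 * sigma * (n * K0) * (a * y).
  by rewrite /m normrM ger0_norm ?mulr_ge0// -mulrA ler_wpM2l ?mulr_ge0// mulrA.
have a2y2' : a ^+ 2 * y ^+ 2 <= a * y ^+ 2.
  by rewrite ler_wpM2r ?exprn_ge0// expr2 ler_piMl.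
have qK : `|r' - r| <= K2 * (a * y ^+ 2).
  rewrite r'E addrC addKr; apply: (le_trans (ler_normD _ _)).
  rewrite /K2 [leRHS]mulrDl lerD//.
    by apply: (le_trans mK); rewrite ler_wpM2l ?mulr_ge0// ler_wpM2l.
  by apply: (le_trans rhoK); rewrite ler_wpM2l.
have a3y6 : 0 <= a ^+ 3 * y ^+ 6 by rewrite mulr_ge0// exprn_ge0.
(* The error has three parts: the Taylor remainder here, the replacement of [r' - r] by [m] in the
   quadratic term in [tB], and the terms of |D + sigma xi|^2 containing [D] in [tC]. The cube of the
   bound [qK] is the origin of [y ^+ 6]. *)
have tA : `|g (Num.min r' M) - g r - g1 r * (r' - r) - g2 r * (r' - r) ^+ 2 / 2|
    <= KA * (a ^+ 3 * y ^+ 6).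
  apply: (le_trans (taylor r r' z0 zl (sqn_ge0 _))).
  rewrite /KA -mulrA ler_wpM2l//.
  apply: (@le_trans _ _ ((K2 * (a * y ^+ 2)) ^+ 3)).
    by rewrite lerXn2r ?nnegrE ?mulr_ge0// exprn_ge0.
  by rewrite le_eqVlt; apply/orP; left; apply/eqP; ring.
have yn k : 0 <= y ^+ k by rewrite exprn_ge0.
have an k : 0 <= a ^+ k by rewrite exprn_ge0.
have y46 : y ^+ 4 <= y ^+ 6 by rewrite ler_weXn2l.
have g2l : g2 r <= g2 l2 by exact: lyap2_le.
have g1l : g1 r <= g1 l2 by exact: lyap1_le.
have tB : `|g2 r / 2 * ((r' - r) ^+ 2 - m ^+ 2)| <= KB * (a ^+ 3 * y ^+ 6).
  have -> : (r' - r) ^+ 2 - m ^+ 2 = rho * (rho + 2 * m).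
    by rewrite r'E; ring.
  rewrite normrM normrM (ger0_norm (lyap2_ge0 _ _ _))// normfV (ger0_norm (ler0n _ 2)).
  apply: (@le_trans _ _ (g2 l2 * `|rho * (rho + 2 * m)|)).
    rewrite ler_wpM2r// ler_pdivrMr//; apply: (le_trans g2l).
    by rewrite ler_peMr ?lyap2_ge0// ler1n.
  rewrite /KB -[leRHS]mulrA ler_wpM2l ?lyap2_ge0// normrM.
  apply: (@le_trans _ _ (K1 * (a ^+ 2 * y ^+ 2) *
      ((K1 + 4 * sigma * (n * K0)) * (a * y ^+ 2)))).
    apply: ler_pM => //.
    apply: (le_trans (ler_normD _ _)); rewrite normrM (ger0_norm (ler0n _ 2)).
    rewrite [leRHS]mulrDl lerD//; first by apply: (le_trans rhoK); rewrite ler_wpM2l.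
    apply: (@le_trans _ _ (2 * (2 * sigma * (n * K0) * (a * y)))).
      by rewrite ler_wpM2l.
    apply: (@le_trans _ _ (2 * (2 * sigma * (n * K0) * (a * y ^+ 2)))).
      by rewrite ler_wpM2l// ler_wpM2l ?mulr_ge0// ler_wpM2l.
    by rewrite le_eqVlt; apply/orP; left; apply/eqP; ring.
  rewrite [leLHS](_ : _ = K1 * (K1 + 4 * sigma * (n * K0)) * (a ^+ 3 * y ^+ 4)); last by ring.
  have K14 : 0 <= K1 * (K1 + 4 * sigma * (n * K0)) by nonneg.
  by apply: ler_wpM2l => //; apply: ler_wpM2l.
have tC : `|g1 r * (2 * sigma * dotp D xi + sqn D)| <= KC * (a ^+ 3 * y ^+ 6).
  rewrite normrM (ger0_norm (lyap1_ge0 _ _ _ _))//.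
  rewrite /KC -[leRHS]mulrA; apply: ler_pM; rewrite ?lyap1_ge0//.
  have y16 : y <= y ^+ 6 by rewrite -[leLHS]expr1 ler_weXn2l.
  have h1 : `|dotp D xi| <= n * c * (a ^+ 3 * y ^+ 6).
    apply: (@le_trans _ _ (n * (c * a ^+ 2 * (a * y)))).
      by apply: dotp_norm_le => //; rewrite mulr_ge0.
    rewrite [leLHS](_ : _ = n * c * (a ^+ 3 * y)); last by ring.
    by rewrite ler_wpM2l ?mulr_ge0// ler_wpM2l.
  have h2 : sqn D <= n * c ^+ 2 * (a ^+ 3 * y ^+ 6).
    have -> : sqn D = dotp D D by apply: eq_bigr => i _; rewrite expr2.
    apply: (le_trans (ler_norm _)).
    apply: (@le_trans _ _ (n * (c * a ^+ 2 * (c * a ^+ 2)))).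
      by apply: dotp_norm_le => //; rewrite mulr_ge0.
    rewrite [leLHS](_ : _ = n * c ^+ 2 * (a ^+ 3 * a)); last by ring.
    rewrite ler_wpM2l ?mulr_ge0 ?exprn_ge0// ler_wpM2l//.
    by rewrite (le_trans a1)// (le_trans y1).
  apply: (le_trans (ler_normD _ _)); rewrite [leRHS]mulrDl lerD//.
    rewrite normrM ger0_norm ?mulr_ge0// -!(mulrA 2) -!(mulrA sigma) !ler_wpM2l//.
  by rewrite ger0_norm ?sqn_ge0.
rewrite -/r -/r'.
rewrite [X in `|X|](_ : _ =
   (g (Num.min r' M) - g r - g1 r * (r' - r) - g2 r * (r' - r) ^+ 2 / 2)
   + (g2 r / 2 * ((r' - r) ^+ 2 - m ^+ 2))
   + g1 r * (2 * sigma * dotp D xi + sqn D)).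
  rewrite [leRHS]mulrDl [X in _ <= X + _]mulrDl; apply: (le_trans (ler_normD _ _)).
  by rewrite lerD//; apply: (le_trans (ler_normD _ _)); rewrite lerD.
have e1 : dotp z (fun i => D i + theta * a ^+ 2 * z i) = dotp z D + theta * a ^+ 2 * r.
  rewrite /dotp /r /sqn mulr_sumr -big_split /=; apply: eq_bigr => i _; ring.
have e2 : sqn (fun i => D i + sigma * xi i) =
    sqn D + 2 * sigma * dotp D xi + sigma ^+ 2 * sqn xi.
  rewrite /dotp /sqn !mulr_sumr -!big_split /=; apply: eq_bigr => i _; ring.
rewrite e1 /generator /martingale_part -/r r'E /m /rho e2 -/n.
by field.
Qed.

End one_step.

Definition clip (R : realType) (b v : R) := Num.max (- b) (Num.min v b).

Lemma clip_norm_le (R : realType) (b v : R) : 0 <= b -> `|clip b v| <= b.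
Proof.
move=> b0; rewrite ler_norml /clip le_max lexx /= ge_max ge_min lexx orbT andbT.
by rewrite (le_trans _ b0)// oppr_le0.
Qed.

Lemma clip_id (R : realType) (b v : R) : `|v| <= b -> clip b v = v.
Proof.
by rewrite ler_norml /clip => /andP[bv vb]; rewrite min_l// max_r.
Qed.

(** * The stopped scheme with clipped drift *)

Section scheme.
Context (disp : measure_display) (Omega : measurableType disp) (R : realType)
  (P : probability Omega R) (d : nat) (B X : R -> Omega -> 'rV[R]_d).
Hypothesis hB : standard_BM P B.
Hypothesis hindep : independent2 P (sigma_process [set 0] X)
                                   (sigma_process [set t | 0 <= t] B).
Hypothesis mX : forall t i, 0 <= t -> measurable_fun setT (fun w => X t w 0 i).
Hypothesis adX : forall t, 0 <= t ->
    sigma_process [set t] X `<=` augmented_filtration P B X t.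
Variables (sigma theta : R).
Hypothesis sigma0 : 0 < sigma.
Variables (l2 c : R).
Hypothesis l20 : 0 <= l2.

Section fixed_step.
Variable a : R.
Hypothesis a0 : 0 < a.
Local Notation h := (a ^+ 2).

(* The time step is [a ^+ 2], so that [a] is the standard deviation of the Brownian
   increments [dB]. *)
Definition grid (k : nat) : R := k%:R * h.

Definition dB (k : nat) (w : Omega) (i : 'I_d) : R :=
  B (grid k.+1) w 0 i - B (grid k) w 0 i.

Definition raw_drift (k : nat) (w : Omega) (i : 'I_d) : R :=
  X (grid k.+1) w 0 i - X (grid k) w 0 i - sigma * dB k w i.

(* The clipping bounds the drift uniformly in [w], and it is inactive on regular
   paths as long as they stay in the ball (see [scheme_eq_path]). *)
Definition drift k w i := clip (c * h) (raw_drift k w i).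

(** The scheme is frozen at its first point outside the open ball, so being alive is monotone in [k]
    and the exit position is kept until the horizon. *)
Fixpoint scheme (k : nat) (w : Omega) : 'I_d -> R :=
  match k with
  | 0 => fun i => X 0 w 0 i
  | k.+1 => fun i => if sqn (scheme k w) < l2
      then scheme k w i + (drift k w i + sigma * dB k w i) else scheme k w i
  end.

Definition alive k w : bool := sqn (scheme k w) < l2.

Lemma grid_ge0 k : 0 <= grid k.
Proof. by rewrite mulr_ge0// exprn_ge0// ltW. Qed.

Lemma grid_lt k k' : (k < k')%N -> grid k < grid k'.
Proof. by move=> kk'; rewrite ltr_pM2r ?exprn_gt0// ltr_nat. Qed.

Lemma grid_le k k' : (k <= k')%N -> grid k <= grid k'.
Proof. by move=> kk'; rewrite ler_pM2r ?exprn_gt0// ler_nat. Qed.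

Lemma gridS k : grid k.+1 - grid k = h.
Proof. by rewrite /grid -mulrBl -natrB// subSnn mul1r. Qed.

Let PT (j : 'I_d) k := g_sigma_algebraType (past P B X j (grid k)).

Lemma past_measurable_fun (j : 'I_d) k (f : Omega -> R) :
  measurable_fun (setT : set (PT j k)) f -> measurable_fun setT f.
Proof.
move=> mf _ U mU.
have := mf measurableT U mU.
rewrite (_ : @measurable _ (PT j k) = past P B X j (grid k)); last first.
  exact/measurable_g_measurableTypeE/past_sigma_algebra.
by case.
Qed.

Lemma measurable_sqn d' (T' : measurableType d') (f : T' -> 'I_d -> R) :
  (forall i, measurable_fun setT (fun w => f w i)) ->
  measurable_fun setT (fun w => sqn (f w)).
Proof. by move=> mf; apply: measurable_sum => i; exact: measurable_funX. Qed.

Lemma scheme_past (j : 'I_d) k k' i : (k <= k')%N ->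
  measurable_fun (setT : set (PT j k')) (fun w => scheme k w i).
Proof.
elim: k i => [|k IH] i kk' /=.
  by apply: past_mX => //; rewrite lexx grid_ge0.
have mk := fun i => IH i (ltnW kk').
have mB k0 : (k0 <= k')%N ->
    measurable_fun (setT : set (PT j k')) (fun w => B (grid k0) w 0 i).
  by move=> k0k; apply: past_mB => // [|_]; [exact: grid_ge0|exact: grid_le].
have mX' k0 : (k0 <= k')%N ->
    measurable_fun (setT : set (PT j k')) (fun w => X (grid k0) w 0 i).
  by move=> k0k; apply: past_mX => //; rewrite grid_ge0 grid_le.
have mdB : measurable_fun (setT : set (PT j k')) (fun w => sigma * dB k w i).
  by apply: measurable_funM => //; apply: measurable_funB; apply: mB => //; exact: ltnW.
apply: measurable_fun_ifT => //.
  by apply: measurable_fun_ltr => //; exact: (@measurable_sqn _ (PT j k')).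
apply: measurable_funD => //; apply: measurable_funD => //.
apply: measurable_maxr => //; apply: measurable_minr => //.
by apply: measurable_funB => //; apply: measurable_funB; apply: mX' => //; exact: ltnW.
Qed.

Lemma dB_past (j i : 'I_d) k : i != j ->
  measurable_fun (setT : set (PT j k)) (fun w => dB k w i).
Proof.
by move=> /negbTE ij; apply: measurable_funB; apply: past_mB;
  rewrite ?grid_ge0 ?ij.
Qed.

Lemma alive_past (j : 'I_d) k : measurable_fun (setT : set (PT j k)) (alive k).
Proof.
apply: measurable_fun_ltr => //.
by apply: (@measurable_sqn _ (PT j k)) => i; exact: scheme_past.
Qed.

Lemma dB_measurable k i : measurable_fun setT (fun w => dB k w i).
Proof.
by apply: measurable_funB; apply: (bm1_measurable (bm_coord hB i)); exact: grid_ge0.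
Qed.

Lemma dB_gaussian k i A : measurable A ->
  pushforward P (fun w => dB k w i) A = normal_prob 0 a A.
Proof.
move=> mA; rewrite (bm1_gaussian_increments (bm_coord hB i)) ?grid_ge0 ?grid_lt//.
by rewrite gridS sqrtr_sqr ger0_norm// ltW.
Qed.

Lemma dB_indep (j : 'I_d) k (Y : Omega -> R) (psi : R -> R) :
  measurable_fun (setT : set (PT j k)) Y -> measurable_fun setT psi ->
  finite_mean P Y -> finite_mean P (fun w => psi (dB k w j)) ->
  finite_mean P (fun w => Y w * psi (dB k w j)) /\
  mean P (fun w => Y w * psi (dB k w j)) =
    mean P Y * mean P (fun w => psi (dB k w j)).
Proof.
move=> mY mpsi iY iZ.
have H U V : measurable U -> measurable V ->
    P (Y @^-1` U `&` (fun w => psi (dB k w j)) @^-1` V) =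
    (P (Y @^-1` U) * P ((fun w => psi (dB k w j)) @^-1` V))%E.
  move=> mU mV.
  have mV' : measurable (psi @^-1` V) by rewrite -[X in measurable X]setTI; exact: mpsi.
  have := @past_indep _ _ _ _ _ B X hB hindep mX j (grid k) (grid k.+1) _
     (Y @^-1` U) (grid_ge0 k) (ltW (grid_lt (ltnSn k))) mV'.
  apply.
  have := mY measurableT U mU; rewrite setTI.
  rewrite (_ : @measurable _ (PT j k) = past P B X j (grid k))//.
  exact/measurable_g_measurableTypeE/past_sigma_algebra.
split; first exact: integrable_indepM iY iZ H.
exact: expectation_indepM iY iZ H.
Qed.

Let zero_mean f := finite_mean P f /\ mean P f = 0.

Let zero_meanD f g :
  zero_mean f -> zero_mean g -> zero_mean (fun w => f w + g w).
Proof.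
move=> [If f0] [Ig g0]; split; first exact: finite_meanD.
by rewrite meanD// f0 g0 addr0.
Qed.

Let zero_mean_sum (f : 'I_d -> Omega -> R) :
  (forall i, zero_mean (f i)) -> zero_mean (fun w => \sum_i f i w).
Proof.
move=> h0; split; first by apply: finite_mean_sum => i _; case: (h0 i).
rewrite mean_sum => [|i _]; last by case: (h0 i).
by rewrite big1// => i _; case: (h0 i).
Qed.

(** The class [past] depends on a coordinate; asking for all of them lets one factor [Y] be paired
    with the increment of any coordinate. *)
Definition all_past k (Y : Omega -> R) :=
  forall j, measurable_fun (setT : set (PT j k)) Y.

Lemma finite_mean_dB k i n : finite_mean P (fun w => dB k w i ^+ n).
Proof.
by apply: (finite_mean_gaussian_pow (dB_measurable k i) a0 (@dB_gaussian k i)).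
Qed.

Lemma finite_mean_past k (Y : Omega -> R) (b : R) (i : 'I_d) :
  all_past k Y -> (forall w, `|Y w| <= b) -> finite_mean P Y.
Proof.
by move=> mY; apply: finite_mean_bounded; exact: (@past_measurable_fun i k).
Qed.

Lemma past_dB_mean0 k Y b i : all_past k Y -> (forall w, `|Y w| <= b) ->
  zero_mean (fun w => Y w * dB k w i).
Proof.
move=> mY Yb; have IY := finite_mean_past i mY Yb.
have I1 : finite_mean P (fun w => dB k w i).
  by have := @finite_mean_dB k i 1; under eq_fun do rewrite expr1.
have [I2 E] := dB_indep (mY i) (@measurable_id _ _ setT) IY I1; split => //.
have [m1 _] := gaussian_mean_var (dB_measurable k i) a0 (@dB_gaussian k i).
by rewrite [LHS]E [X in _ * X]m1 mulr0.
Qed.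

Lemma past_dB2_mean0 k Y b i : all_past k Y -> (forall w, `|Y w| <= b) ->
  zero_mean (fun w => Y w * (dB k w i ^+ 2 - h)).
Proof.
move=> mY Yb; have IY := finite_mean_past i mY Yb.
have I2 : finite_mean P (fun w => dB k w i ^+ 2 - h).
  by apply: finite_meanB; [exact: finite_mean_dB|exact: finite_mean_cst].
have mpsi : measurable_fun setT (fun x : R => x ^+ 2 - h).
  by apply: measurable_funB => //; exact: measurable_funX.
have [I3 E] := dB_indep (mY i) mpsi IY I2; split => //.
rewrite [LHS]E [X in _ * X](_ : _ = 0) ?mulr0//.
have [_ m2] := gaussian_mean_var (dB_measurable k i) a0 (@dB_gaussian k i).
rewrite (meanB (@finite_mean_dB k i 2) (finite_mean_cst P h)) mean_cst.
by rewrite [X in X - _]m2 subrr.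
Qed.

(** The product of [Y] and the increment of coordinate [i] belongs to the past relative to [j],
    which contains the whole of coordinate [i]; the increment of [j] is independent of it and
    centred. *)
Lemma past_dBdB_mean0 k Y b i j : i != j ->
  all_past k Y -> (forall w, `|Y w| <= b) ->
  zero_mean (fun w => Y w * (dB k w i * dB k w j)).
Proof.
move=> ij mY Yb; have [I0 _] := past_dB_mean0 i mY Yb.
have I1 : finite_mean P (fun w => dB k w j).
  by have := @finite_mean_dB k j 1; under eq_fun do rewrite expr1.
have mYi : measurable_fun (setT : set (PT j k)) (fun w => Y w * dB k w i).
  by apply: measurable_funM => //; exact: dB_past.
have [I2 E] := dB_indep mYi (@measurable_id _ _ setT) I0 I1.
have -> : (fun w => Y w * (dB k w i * dB k w j)) =
    (fun w => Y w * dB k w i * id (dB k w j)).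
  by apply/funext => w; rewrite mulrA.
split => //; have [m1 _] := gaussian_mean_var (dB_measurable k j) a0 (@dB_gaussian k j).
by rewrite [LHS]E [X in _ * X]m1 mulr0.
Qed.

Definition alive_ind k w : R := (alive k w)%:R.

Lemma alive_ind_past k : all_past k (alive_ind k).
Proof.
move=> j; rewrite (_ : alive_ind k = (fun w => if alive k w then 1 else 0)).
  by apply: measurable_fun_ifT => //; exact: alive_past.
by apply/funext => w; rewrite /alive_ind; case: alive.
Qed.

Lemma scheme_bound k w i : alive k w -> `|scheme k w i| <= 1 + l2.
Proof.
rewrite /alive => zl; set z := scheme k w i.
have hz : `|z| ^+ 2 <= l2.
  rewrite real_normK ?num_real//; exact: le_trans (coord_le_sqn (scheme k w) i) (ltW zl).
have [zi1|zi1] := leP `|z| 1; first by rewrite (le_trans zi1)// lerDl.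
have h1 : `|z| <= `|z| ^+ 2 by rewrite expr2 ler_peMl// ltW.
by rewrite (le_trans h1)// (le_trans hz)// lerDr.
Qed.

Section lyapunov.
Variables (alpha beta mu : R).
Hypotheses (alpha0 : 0 <= alpha) (beta0 : 0 <= beta) (mu0 : 0 <= mu).

Local Notation g := (lyap alpha beta mu).
Local Notation g1 := (lyap1 alpha beta mu).
Local Notation g2 := (lyap2 alpha mu).

Let measurable_expZ (k : R) : measurable_fun setT (fun x : R => expR (k * x)).
Proof. by apply: measurableT_comp => //; exact: measurable_funM. Qed.

Lemma measurable_lyap : measurable_fun setT g.
Proof. by apply: measurable_funD; exact: measurable_funM. Qed.

Lemma measurable_lyap1 : measurable_fun setT g1.
Proof. by apply: measurable_funD => //; exact: measurable_funM. Qed.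

Lemma measurable_lyap2 : measurable_fun setT g2.
Proof. exact: measurable_funM. Qed.

Lemma measurable_generator :
  measurable_fun setT (generator d alpha beta mu sigma theta).
Proof.
apply: measurable_funD.
  apply: measurable_funM; first exact: measurable_lyap1.
  by apply: measurable_funB => //; exact: measurable_funM.
apply: measurable_funM; last exact: measurable_lyap2.
by apply: measurable_funM.
Qed.

Lemma sqn_past k : all_past k (fun w => sqn (scheme k w)).
Proof.
by move=> j; apply: (@measurable_sqn _ (PT j k)) => i; exact: scheme_past.
Qed.

(** Each summand is a function of [z] times a centred expression in the increments: linear, a square
    minus its variance, or a product of two distinct coordinates. *)
Lemma martingale_partE (z xi : 'I_d -> R) :
  martingale_part alpha beta mu sigma h z xi =
  \sum_i (2 * sigma * g1 (sqn z) * z i) * xi i +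
  \sum_i (sigma ^+ 2 * g1 (sqn z)) * (xi i ^+ 2 - h) +
  \sum_i \sum_j (2 * sigma ^+ 2 * g2 (sqn z) * (z i * z j)) *
     (if i == j then xi i ^+ 2 - h else xi i * xi j).
Proof.
rewrite /martingale_part mulrDr; congr (_ + _ + _).
- by rewrite /dotp !mulr_sumr; apply: eq_bigr => i _; ring.
- rewrite -mulr_sumr sumrB sumr_const card_ord -[h *+ d]mulr_natl.
  by rewrite [g1 _ * _]mulrA [g1 _ * _]mulrC.
- have -> : dotp z xi ^+ 2 - h * sqn z = \sum_i \sum_j (z i * z j) *
     (if i == j then xi i ^+ 2 - h else xi i * xi j).
    rewrite expr2 /dotp big_distrlr /= /sqn mulr_sumr -sumrB.
    apply: eq_bigr => i _.
    rewrite (bigD1 i)//= [RHS](bigD1 i)//= eqxx.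
    rewrite -addrA [_ - h * _]addrC addrA; congr (_ + _); first by ring.
    by apply: eq_bigr => j ji; rewrite eq_sym (negbTE ji); ring.
  rewrite mulr_sumr; apply: eq_bigr => i _; rewrite mulr_sumr.
  by apply: eq_bigr => j _; rewrite mulrA.
Qed.

(** The indicator makes the past-measurable coefficients bounded, since the scheme is in the ball
    while alive; the three kinds of summands then have mean zero separately. *)
Lemma martingale_mean0 k :
  zero_mean (fun w => alive_ind k w *
    martingale_part alpha beta mu sigma h (scheme k w) (dB k w)).
Proof.
have -> : (fun w => alive_ind k w *
    martingale_part alpha beta mu sigma h (scheme k w) (dB k w)) = (fun w =>
  \sum_i (alive_ind k w * (2 * sigma * g1 (sqn (scheme k w)) * scheme k w i)) * dB k w i +
  \sum_i (alive_ind k w * (sigma ^+ 2 * g1 (sqn (scheme k w)))) * (dB k w i ^+ 2 - h) +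
  \sum_i \sum_j (alive_ind k w * (2 * sigma ^+ 2 * g2 (sqn (scheme k w)) *
       (scheme k w i * scheme k w j))) *
     (if i == j then dB k w i ^+ 2 - h else dB k w i * dB k w j)).
  apply/funext => w; rewrite martingale_partE.
  move: (g1 _) (g2 _) (alive_ind k w) => G1 G2 A.
  rewrite [LHS]mulrDr [X in X + _]mulrDr.
  rewrite 3!mulr_sumr; congr (_ + _ + _); apply: eq_bigr => i _; rewrite ?mulrA//.
  by rewrite mulr_sumr; apply: eq_bigr => j _; rewrite !mulrA.
have mg1 : all_past k (fun w => g1 (sqn (scheme k w))).
  by move=> j; apply: (measurableT_comp measurable_lyap1); exact: sqn_past.
have mg2 : all_past k (fun w => g2 (sqn (scheme k w))).
  by move=> j; apply: (measurableT_comp measurable_lyap2); exact: sqn_past.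
have s0 : 0 <= sigma by exact: ltW.
have s20 : 0 <= sigma ^+ 2 by exact: exprn_ge0.
have l20' : 0 <= 1 + l2 by rewrite addr_ge0.
have al_le (w : Omega) (y b : R) : 0 <= b -> (alive k w -> `|y| <= b) -> `|alive_ind k w * y| <= b.
  rewrite /alive_ind; case: alive => b0 yb; first by rewrite mul1r yb.
  by rewrite mul0r normr0.
have g1b w : alive k w -> `|g1 (sqn (scheme k w))| <= g1 l2.
  by move=> Hw; rewrite ger0_norm ?lyap1_ge0// lyap1_le// ltW.
have g2b w : alive k w -> `|g2 (sqn (scheme k w))| <= g2 l2.
  by move=> Hw; rewrite ger0_norm ?lyap2_ge0// lyap2_le// ltW.
have g1l0 : 0 <= g1 l2 by exact: lyap1_ge0.
have g2l0 : 0 <= g2 l2 by exact: lyap2_ge0.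
apply: zero_meanD; first apply: zero_meanD.
- apply: zero_mean_sum => i.
  apply: (@past_dB_mean0 _ _ (2 * sigma * g1 l2 * (1 + l2))).
    move=> j; apply: measurable_funM; first exact: alive_ind_past.
    apply: measurable_funM; last exact: scheme_past.
    by apply: measurable_funM => //; exact: mg1.
  move=> w; apply: al_le; first by rewrite !mulr_ge0.
  move=> Hw; rewrite !normrM (ger0_norm s0) (ger0_norm (ler0n _ 2)).
  apply: ler_pM; rewrite ?mulr_ge0//; last exact: scheme_bound.
  by rewrite ler_wpM2l ?mulr_ge0// g1b.
- apply: zero_mean_sum => i.
  apply: (@past_dB2_mean0 _ _ (sigma ^+ 2 * g1 l2)).
    move=> j; apply: measurable_funM; first exact: alive_ind_past.
    by apply: measurable_funM => //; exact: mg1.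
  move=> w; apply: al_le; first by rewrite mulr_ge0.
  by move=> Hw; rewrite normrM (ger0_norm s20) ler_wpM2l// g1b.
- apply: zero_mean_sum => i; apply: zero_mean_sum => j.
  set Y := (fun w => alive_ind k w * (2 * sigma ^+ 2 * g2 (sqn (scheme k w)) *
       (scheme k w i * scheme k w j))).
  have mY : all_past k Y.
    move=> j0; apply: measurable_funM; first exact: alive_ind_past.
    apply: measurable_funM; last by apply: measurable_funM; exact: scheme_past.
    by apply: measurable_funM => //; exact: mg2.
  have Yb w : `|Y w| <= 2 * sigma ^+ 2 * g2 l2 * ((1 + l2) * (1 + l2)).
    apply: al_le; first by rewrite !mulr_ge0.
    move=> Hw; rewrite normrM; apply: ler_pM => //.
      rewrite normrM (ger0_norm (mulr_ge0 (ler0n _ 2) s20)).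
      by rewrite ler_wpM2l ?mulr_ge0// g2b.
    by rewrite normrM; apply: ler_pM => //; exact: scheme_bound.
  rewrite (_ : (fun w => _) = (fun w => Y w *
     (if i == j then dB k w i ^+ 2 - h else dB k w i * dB k w j)))//.
  have [ij|ij] := eqVneq i j; first exact: (past_dB2_mean0 i mY Yb).
  exact: (past_dBdB_mean0 ij mY Yb).
Qed.

End lyapunov.
End fixed_step.
End scheme.

(** * Mean drift of the stopped scheme *)

Section scheme_estimate.
Context (disp : measure_display) (Omega : measurableType disp) (R : realType)
  (P : probability Omega R) (d : nat) (hd : (0 < d)%N)
  (B X : R -> Omega -> 'rV[R]_d).
Hypothesis hB : standard_BM P B.
Hypothesis hindep : independent2 P (sigma_process [set 0] X)
                                   (sigma_process [set t | 0 <= t] B).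
Hypothesis mX : forall t i, 0 <= t -> measurable_fun setT (fun w => X t w 0 i).
Hypothesis adX : forall t, 0 <= t ->
    sigma_process [set t] X `<=` augmented_filtration P B X t.
Variables (sigma theta : R).
Hypotheses (sigma0 : 0 < sigma) (theta0 : 0 < theta).
Variables (l2 c : R).
Hypotheses (l20 : 0 <= l2) (c0 : 0 <= c).

Let i0 : 'I_d := Ordinal hd.

Local Notation scheme := (scheme B X sigma l2 c).
Local Notation drift := (drift B X sigma c).
Local Notation alive' := (alive B X sigma l2 c).
Local Notation alive_ind' := (alive_ind B X sigma l2 c).

(** Distance, on live steps, of the clipped drift from the Euler drift -theta h z. It is of order h
    uniformly, and of smaller order only along a regular path. *)
Definition drift_error a k w : R :=
  alive_ind' a k w * \sum_i `|drift a k w i + theta * a ^+ 2 * scheme a k w i|.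

Lemma scheme_measurable a k i : 0 < a ->
  measurable_fun setT (fun w => scheme a k w i).
Proof.
move=> a0; exact: (past_measurable_fun (scheme_past hB mX adX sigma l2 c a0 (j := i0) i (leqnn k))).
Qed.

Lemma sqn_scheme_measurable a k : 0 < a ->
  measurable_fun setT (fun w => sqn (scheme a k w)).
Proof. by move=> a0; apply: measurable_sqn => i; exact: scheme_measurable. Qed.

Lemma alive_ind_measurable a k : 0 < a -> measurable_fun setT (alive_ind' a k).
Proof.
move=> a0.
exact: (past_measurable_fun (alive_ind_past hB mX adX sigma l2 c a0 (k := k) (j := i0))).
Qed.

Lemma alive_ind_bound a k w : 0 <= alive_ind' a k w <= 1.
Proof. by rewrite /alive_ind; case: alive; rewrite ler01 lexx. Qed.

Lemma finite_mean_alive_ind a k : 0 < a -> finite_mean P (alive_ind' a k).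
Proof.
move=> a0; apply: (@finite_mean_bounded _ _ _ _ _ 1); first exact: alive_ind_measurable.
by move=> w; have /andP[h0 h1] := alive_ind_bound a k w; rewrite ger0_norm.
Qed.

Lemma drift_measurable a k i : 0 < a ->
  measurable_fun setT (fun w => drift a k w i).
Proof.
move=> a0; apply: measurable_maxr => //; apply: measurable_minr => //.
apply: measurable_funB.
  by apply: measurable_funB; apply: mX; exact: grid_ge0.
by apply: measurable_funM => //; exact: (dB_measurable hB a0).
Qed.

Lemma drift_bound a k w i : `|drift a k w i| <= c * a ^+ 2.
Proof. by apply: clip_norm_le; rewrite mulr_ge0// sqr_ge0. Qed.

Lemma drift_error_bound a k w :
  0 <= drift_error a k w <= d%:R * (c + theta * (1 + l2)) * a ^+ 2.
Proof.
rewrite /drift_error /alive_ind; case: (boolP (alive' a k w)) => Hw; last first.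
  have h : 0 <= c + theta * (1 + l2).
    by rewrite addr_ge0// mulr_ge0 ?addr_ge0// ltW.
  by rewrite mul0r lexx /= mulr_ge0 ?sqr_ge0// mulr_ge0.
rewrite mul1r sumr_ge0//=.
rewrite -mulrA mulr_natl -[X in _ *+ X]card_ord -sumr_const; apply: ler_sum => i _.
apply: (le_trans (ler_normD _ _)); rewrite mulrDl lerD ?drift_bound//.
rewrite normrM ger0_norm; last by rewrite mulr_ge0 ?sqr_ge0// ltW.
rewrite mulrAC ler_wpM2r ?sqr_ge0// ler_wpM2l ?(ltW theta0)//.
exact: (scheme_bound l20 _ Hw).
Qed.

Lemma drift_error_measurable a k : 0 < a ->
  measurable_fun setT (drift_error a k).
Proof.
move=> a0; apply: measurable_funM; first exact: alive_ind_measurable.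
apply: measurable_sum => i; apply: measurableT_comp => //.
apply: measurable_funD; first exact: drift_measurable.
by apply: measurable_funM => //; exact: scheme_measurable.
Qed.

Lemma finite_mean_drift_error a k : 0 < a -> finite_mean P (drift_error a k).
Proof.
move=> a0; apply: finite_mean_bounded; first exact: drift_error_measurable.
move=> w; have /andP[h0 h1] := drift_error_bound a k w.
by rewrite ger0_norm//; exact: h1.
Qed.

Section lyapunov.
Variables (alpha beta mu M : R).
Hypotheses (alpha0 : 0 <= alpha) (beta0 : 0 <= beta) (mu0 : 0 <= mu) (lM : l2 < M).

Local Notation g := (lyap alpha beta mu).
Local Notation g1 := (lyap1 alpha beta mu).
Local Notation g2 := (lyap2 alpha mu).
Local Notation gen := (generator d alpha beta mu sigma theta).

(** The cap makes the variable bounded although the exit step has an unbounded overshoot and g grows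
    exponentially. *)
Definition capped a k w : R := g (Num.min (sqn (scheme a k w)) M).

Let M0 : 0 <= M. Proof. exact: le_trans l20 (ltW lM). Qed.

Lemma capped_bound a k w : 0 <= capped a k w <= g M.
Proof.
rewrite /capped lyap_ge0//= ?lyap_le// ?ge_min ?lexx ?orbT//.
by rewrite le_min sqn_ge0 M0.
Qed.

Lemma finite_mean_capped a k : 0 < a -> finite_mean P (capped a k).
Proof.
move=> a0; apply: (@finite_mean_bounded _ _ _ _ _ (g M)); last first.
  by move=> w; have /andP[h0 h1] := capped_bound a k w; rewrite ger0_norm.
apply: (measurableT_comp (measurable_lyap alpha beta mu)).
by apply: measurable_minr => //; exact: sqn_scheme_measurable.
Qed.

Definition alive_gen a k w : R := alive_ind' a k w * gen (sqn (scheme a k w)).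

Lemma gen_bound r : 0 <= r -> r <= l2 ->
  `|gen r| <= g1 l2 * (sigma ^+ 2 * d%:R + 2 * theta * l2) + 2 * sigma ^+ 2 * l2 * g2 l2.
Proof.
move=> r0 rl; rewrite /generator.
move: (sigma ^+ 2) (sqr_ge0 sigma) => s2 s20.
have th0 := ltW theta0.
have := lyap1_le beta alpha0 mu0 rl; have := lyap2_le alpha0 mu0 rl.
have := lyap1_ge0 alpha0 beta0 mu0 r; have := lyap2_ge0 alpha0 mu0 r.
move: (g1 r) (g1 l2) (g2 r) (g2 l2) => u1 v1 u2 v2 u20 u10 uv2 uv1.
have v10 := le_trans u10 uv1; have v20 := le_trans u20 uv2.
apply: (le_trans (ler_normD _ _)).
rewrite (normrM u1) (ger0_norm u10).
rewrite [X in _ + X]ger0_norm; last by rewrite !mulr_ge0.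
apply: lerD; last first.
  by apply: ler_pM; rewrite ?mulr_ge0// ler_wpM2l// mulr_ge0.
apply: ler_pM => //.
apply: (le_trans (ler_normB _ _)); apply: lerD.
  by rewrite ger0_norm// mulr_ge0.
by rewrite ger0_norm ?mulr_ge0// ler_wpM2l// mulr_ge0.
Qed.

Lemma finite_mean_alive_gen a k : 0 < a -> finite_mean P (alive_gen a k).
Proof.
move=> a0; set b := g1 l2 * (sigma ^+ 2 * d%:R + 2 * theta * l2) + 2 * sigma ^+ 2 * l2 * g2 l2.
apply: (@finite_mean_bounded _ _ _ _ _ b); last first.
  move=> w; rewrite /alive_gen /alive_ind; case: (boolP (alive' a k w)) => Hw.
    by rewrite mul1r gen_bound ?sqn_ge0// ltW.
  by rewrite mul0r normr0 (le_trans _ (gen_bound l20 (lexx _))).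
apply: measurable_funM; first exact: alive_ind_measurable.
apply: (measurableT_comp (measurable_generator d sigma theta alpha beta mu)).
exact: sqn_scheme_measurable.
Qed.

(** This is the mean of [one_step_taylor] on live states: the martingale part drops out and the
    sixth moments of [dB / a] are bounded by [C6]. On dead states the scheme does not move and the
    left-hand integrand vanishes. *)
Lemma step_estimate : exists K, 0 <= K /\ forall a k, 0 < a -> a <= 1 ->
  `|mean P (capped a k.+1) - mean P (capped a k)
      - a ^+ 2 * mean P (alive_gen a k)|
  <= K * (mean P (drift_error a k) + a ^+ 3).
Proof.
have [K1 [K10 HK]] := one_step_taylor d alpha0 beta0 mu0 theta sigma0 l20 lM c0.
pose C6 : R := 2 * expR 2^-1 * 6`!%:R.
have C60 : 0 <= C6 by rewrite !mulr_ge0 ?expR_ge0.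
(* Bounds the factor 2 g'(|z|^2) |z_i| in front of the drift error of each coordinate. *)
pose K3 := 2 * g1 l2 * (1 + l2).
have K30 : 0 <= K3 by rewrite !mulr_ge0 ?lyap1_ge0 ?addr_ge0.
pose K4 := K1 * (1 + d%:R * C6).
have K40 : 0 <= K4 by rewrite mulr_ge0 ?addr_ge0 ?mulr_ge0.
exists (K3 + K4); split; first exact: addr_ge0.
move=> a k a0 a1.
have [Imart mart0] := martingale_mean0 hB hindep mX adX sigma0 c l20 a0 alpha0 beta0 mu0 k.
set mart := fun w => alive_ind' a k w * _ in Imart mart0.
have I1 := finite_mean_capped k.+1 a0; have I2 := finite_mean_capped k a0.
have I3 := finite_mean_alive_gen k a0; have I4 := finite_mean_drift_error k a0.
have I12 := finite_meanB I1 I2.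
have I3' := finite_meanZ (a ^+ 2) I3.
have I123 := finite_meanB I12 I3'.
have I := finite_meanB I123 Imart.
have -> : mean P (capped a k.+1) - mean P (capped a k) - a ^+ 2 * mean P (alive_gen a k)
   = mean P (fun w => capped a k.+1 w - capped a k w - a ^+ 2 * alive_gen a k w - mart w).
  by rewrite (meanB I123 Imart) mart0 subr0 (meanB I12 I3') (meanB I1 I2) meanZ.
have mp6 i : finite_mean P (fun w => `|dB B a k w i| ^+ 6).
  have := finite_mean_norm (finite_mean_dB hB a0 k i 6).
  by congr finite_mean; apply/funext => w; rewrite normrX.
pose S w := \sum_i (`|dB B a k w i| / a) ^+ 6.
have SE : S = (fun w => \sum_i (a ^-1) ^+ 6 * `|dB B a k w i| ^+ 6).
  by apply/funext => w; apply: eq_bigr => i _; rewrite mulrC exprMn.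
have IS : finite_mean P S.
  by rewrite SE; apply: finite_mean_sum => i _; exact: finite_meanZ.
have mS : mean P S <= d%:R * C6.
  rewrite SE mean_sum => [|i _]; last exact: finite_meanZ.
  rewrite mulr_natl -[X in _ *+ X]card_ord -sumr_const; apply: ler_sum => i _.
  rewrite meanZ//.
  have := mean_gaussian_pow (dB_measurable hB a0 k i) a0 (@dB_gaussian _ _ _ _ _ _ hB _ a0 k i) 6.
  rewrite -/C6 => h6; rewrite exprVn mulrC ler_pdivrMr ?exprn_gt0//.
pose bd w := K3 * drift_error a k w + (K1 * a ^+ 3) * (1 + S w).
have I1S : finite_mean P (fun w => 1 + S w).
  by apply: finite_meanD => //; exact: finite_mean_cst.
have Ibd : finite_mean P bd.
  by apply: finite_meanD; exact: finite_meanZ.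
apply: (@le_trans _ _ (mean P bd)); last first.
  rewrite /bd meanD; [|exact: finite_meanZ..].
  rewrite meanZ// meanZ// meanD//; last exact: finite_mean_cst.
  rewrite mean_cst.
  have e0 : 0 <= mean P (drift_error a k).
    rewrite -(mean_cst P 0); apply: le_mean => //; first exact: finite_mean_cst.
    by move=> w; have /andP[] := drift_error_bound a k w.
  have a30 : 0 <= a ^+ 3 by rewrite exprn_ge0// ltW.
  have : K1 * a ^+ 3 * (1 + mean P S) <= K4 * a ^+ 3.
    by rewrite /K4 mulrAC ler_wpM2r// ler_wpM2l// lerD2l.
  move: (mean P S) (mean P _) e0 => mS' e e0 hS.
  have h1 : 0 <= K4 * e by rewrite mulr_ge0.
  have h2 : 0 <= K3 * a ^+ 3 by rewrite mulr_ge0.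
  rewrite mulrDl !mulrDr; lra.
apply: norm_mean_le => // w.
have S0 : 0 <= S w by apply: sumr_ge0 => i _; rewrite exprn_ge0// divr_ge0// ltW.
have bd0 : 0 <= (K1 * a ^+ 3) * (1 + S w).
  apply: mulr_ge0; last exact: addr_ge0.
  by apply: mulr_ge0 => //; exact/exprn_ge0/ltW.
have [Hw|Hw] := boolP (alive' a k w); last first.
  rewrite /bd /mart /alive_gen /drift_error /alive_ind (negbTE Hw) !mul0r !mulr0 !subr0 add0r.
  rewrite /capped /= -/(alive B X sigma l2 c a k w) (negbTE Hw) subrr normr0.
  exact: bd0.
have := HK a (scheme a k w) (drift a k w) (dB B a k w) a0 a1 (ltW Hw) (drift_bound a k w).
rewrite -/(S w).
have -> : sqn (fun i => scheme a k w i + (drift a k w i + sigma * dB B a k w i))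
   = sqn (scheme a k.+1 w).
  by congr sqn; apply/funext => i /=; move: Hw; rewrite /alive => ->.
have cE : g (sqn (scheme a k w)) = capped a k w.
  by rewrite /capped min_l// ltW// (lt_trans Hw).
rewrite cE -/(capped a k.+1 w).
have -> : a ^+ 2 * gen (sqn (scheme a k w)) = a ^+ 2 * alive_gen a k w.
  by rewrite /alive_gen /alive_ind Hw mul1r.
have -> : martingale_part alpha beta mu sigma (a ^+ 2) (scheme a k w) (dB B a k w) = mart w.
  by rewrite /mart /alive_ind Hw mul1r.
set e := 2 * g1 _ * dotp _ _.
have eK : `|e| <= K3 * drift_error a k w.
  rewrite /e /K3.
  have := lyap1_le beta alpha0 mu0 (ltW Hw).
  have := lyap1_ge0 alpha0 beta0 mu0 (sqn (scheme a k w)).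
  move: (g1 _) (g1 l2) => u1 v1 u10 uv1.
  rewrite normrM normrM (ger0_norm u10) (ger0_norm (ler0n _ 2)).
  rewrite -[leRHS]mulrA; apply: ler_pM; rewrite ?mulr_ge0//.
    by rewrite ler_wpM2l.
  rewrite /drift_error /alive_ind Hw mul1r mulr_sumr.
  apply: (le_trans (ler_norm_sum _ _ _)); apply: ler_sum => i _.
  by rewrite normrM ler_wpM2r// scheme_bound.
move: e eK => e eK hh.
rewrite -[X in `|X|](subrK e); apply: (le_trans (ler_normD _ _)).
by rewrite /bd addrC lerD// (le_trans hh)// mulrA.
Qed.

(** The one-step estimates telescope. Over a horizon n a^2 = T the term n a^3 equals T a, so a
    one-step error of order a^3 is small enough. *)
Lemma scheme_estimate : exists K, 0 <= K /\ forall a n, 0 < a -> a <= 1 ->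
  `|mean P (capped a n) - mean P (capped a 0)
      - a ^+ 2 * \sum_(k < n) mean P (alive_gen a k)|
  <= K * (\sum_(k < n) mean P (drift_error a k) + n%:R * a ^+ 3).
Proof.
have [K [K0 HK]] := step_estimate; exists K; split => // a n a0 a1.
elim: n => [|n IH].
  by rewrite !big_ord0 mul0r addr0 !mulr0 subrr subr0 normr0.
rewrite !big_ord_recr /=.
have := HK a n a0 a1; set u := _ - _ - _ => hu.
set v := _ - _ - _ in IH.
rewrite [X in `|X|](_ : _ = v + u); last by rewrite /u /v; ring.
apply: (le_trans (ler_normD _ _)); apply: (le_trans (lerD IH hu)).
by rewrite le_eqVlt -natr1; apply/orP; left; apply/eqP; ring.
Qed.

End lyapunov.
End scheme_estimate.

(** * Pathwise convergence *)

Section heine.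
Context {R : realType}.

(** Heine's theorem, from the near-covering form of compactness. Putting [delta] under a filter lets
    the finitely many coordinates share one modulus. *)
Lemma within_continuous_unif (f : R -> R) (T e : R) :
  {within [set` `[0, +oo[], continuous f} -> 0 < e ->
  \forall delta \near 0^'+, forall s t, 0 <= s <= T -> 0 <= t <= T ->
    `|s - t| <= delta -> `|f s - f t| <= e.
Proof.
move=> cf e0.
have /compact_near_coveringP/(_ R (0^'+) 
  (fun delta s => forall t, 0 <= s <= T -> 0 <= t <= T ->
    `|s - t| <= delta -> `|f s - f t| <= e) _) := @segment_compact R 0 T.
move=> H; have {}H := H _; apply: filterS (H _).
  move=> delta hd s t s0T; apply: hd => //.
move=> x; rewrite /= in_itv /= => /andP[x0 xT].
have /subspace_continuousP/(_ x) := cf.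
rewrite /= in_itv /= andbT => /(_ x0) /cvgrPdist_le /(_ (e / 2)).
rewrite divr_gt0// => /(_ isT); rewrite nearE /within /= => /nbhs_ballP[r /= r0 xr].
have hr y : 0 <= y -> `|x - y| < r -> `|f x - f y| <= e / 2.
  by move=> y0 xy; apply: xr => //; rewrite in_itv /= y0.
near=> x' delta => t /= /andP[x'0 x'T] /andP[t0 tT] x't.
have xx' : `|x - x'| < r / 2.
  near: x'; apply/nbhs_ballP; exists (r / 2) => /=; first by rewrite divr_gt0.
  by move=> y.
have dr : delta < r / 2 by near: delta; apply: nbhs_right_lt; rewrite divr_gt0.
have h1 : `|f x - f x'| <= e / 2 by apply: hr => //; lra.
have h2 : `|f x - f t| <= e / 2.
  apply: hr => //; rewrite -(subrKA x'); apply: (le_lt_trans (ler_normD _ _)).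
  by lra.
rewrite -(subrKA (f x)); apply: (le_trans (ler_normD _ _)).
by rewrite distrC; lra.
Unshelve. all: by end_near. Qed.

End heine.

Section path_integral.
Context {R : realType}.
Local Notation mu := (@lebesgue_measure R).

(** Left-endpoint rectangle rule on one cell, with the oscillation [e] as error. *)
Lemma Rintegral_increment (f : R -> R) (s t e : R) : 0 <= s -> s <= t ->
  {within [set` `[0, +oo[], continuous f} ->
  (forall r, s <= r <= t -> `|f r - f s| <= e) ->
  `|\int[mu]_(r in [set` `[0, t]]) f r - \int[mu]_(r in [set` `[0, s]]) f r
     - (t - s) * f s| <= (t - s) * e.
Proof.
move=> s0 st cf fe.
have If : mu.-integrable [set` `[0, t]] (EFin \o f).
  apply: continuous_compact_integrable; first exact: segment_compact.
  apply: continuous_subspaceW cf => r /=; rewrite !in_itv /= => /andP[->].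
  by [].
rewrite (Rintegral_itvB If) ?bnd_simp//.
have mI : measurable (`]s, t]%classic : set R) by [].
have muI : fine (mu (`]s, t]%classic)) = t - s.
  rewrite lebesgue_measure_itv /= lte_fin; case: ltP => //.
  by move=> ts; rewrite (@le_anti _ _ s t) ?subrr// st ts.
have Ic (k : R) : mu.-integrable [set` `]s, t]] (EFin \o (fun=> k)).
  apply/integrableP; split; first by apply/measurable_EFinP.
  rewrite /= integral_cst//= lebesgue_measure_itv /=.
  by case: ifP => _; rewrite ?mule0 ?ltry// -EFinD -EFinM ltry.
have If' : mu.-integrable [set` `]s, t]] (EFin \o f).
  apply: integrableS If => //; apply: subset_itvr; rewrite bnd_simp//.
have -> : (t - s) * f s = \int[mu]_(r in [set` `]s, t]]) (f s).
  by rewrite Rintegral_cst// mulrC muI.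
have -> : (t - s) * e = \int[mu]_(r in [set` `]s, t]]) e.
  by rewrite Rintegral_cst// mulrC muI.
have IB : mu.-integrable [set` `]s, t]] (EFin \o (fun r => f r - f s)).
  rewrite (_ : EFin \o _ = (EFin \o f) \- (EFin \o (fun=> f s)))%E//.
  exact: integrableB.
rewrite -RintegralB//; apply: (le_trans (le_normr_Rintegral _ _)) => //.
apply: le_Rintegral => //.
- exact: integrable_norm.
- by move=> r /=; rewrite in_itv /= => /andP[sr rt]; apply: fe; rewrite rt ltW.
Qed.

End path_integral.

Section pathwise.
Context (disp : measure_display) (Omega : measurableType disp) (R : realType)
  (d : nat) (B X : R -> Omega -> 'rV[R]_d) (w : Omega).
Variables (sigma theta : R).
Hypotheses (theta0 : 0 < theta).
Hypothesis cX : {within [set` `[0, +oo[], continuous (fun t => X t w)}.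
Hypothesis eqX : forall t (i : 'I_d), 0 <= t ->
    X t w 0 i = X 0 w 0 i
      - theta * (\int[lebesgue_measure]_(s in [set` `[0, t]]) X s w 0 i)
      + sigma * (B t w 0 i - B 0 w 0 i).

Variables (l2 L : R).
Hypotheses (L0 : 0 <= L) (l2L : l2 <= L ^+ 2).
Local Notation c := (theta * (L + 1)).

Local Notation schemew a k := (scheme B X sigma l2 c a k w).
Local Notation alivew a k := (alive B X sigma l2 c a k w).
Local Notation alw a k := (alive_ind B X sigma l2 c a k w).
Local Notation errw a k := (drift_error B X sigma theta l2 c a k w).
Local Notation x t := (fun i : 'I_d => X t w 0 i).

Lemma coord_within_continuous (i : 'I_d) :
  {within [set` `[0, +oo[], continuous (fun t => X t w 0 i)}.
Proof.
apply/subspace_continuousP => t At.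
have /subspace_continuousP/(_ t At) := cX => h.
exact: (continuous_cvg _ (@coord_continuous _ _ _ 0 i (X t w)) h).
Qed.

Definition modulus (a e T : R) := forall i s t, 0 <= s <= T -> 0 <= t <= T ->
  `|s - t| <= a ^+ 2 -> `|X s w 0 i - X t w 0 i| <= e.

Section fixed_step.
Variables (a e : R) (n : nat).
Hypotheses (a0 : 0 < a) (e0 : 0 <= e) (e1 : e <= 1).
Hypothesis me : modulus a e (grid a n).

Let h0 : 0 < a ^+ 2. Proof. exact: exprn_gt0. Qed.

Lemma alive_pred k : alivew a k.+1 -> alivew a k.
Proof.
rewrite /alive /=; case: (boolP (sqn (schemew a k) < l2)) => // /negbTE.
by rewrite /sqn => ->.
Qed.

Lemma alive_le j k : (j <= k)%N -> alivew a k -> alivew a j.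
Proof.
move=> /subnK <-; elim: (k - j)%N => [//|m IH]; rewrite addSn => /alive_pred.
exact: IH.
Qed.

(** Subtracting the noise in the integral equation leaves exactly -theta times the integral of the
    path over the cell. *)
Lemma path_increment (k : nat) i : (k < n)%N ->
  `|raw_drift B X sigma a k w i + theta * a ^+ 2 * X (grid a k) w 0 i|
     <= theta * e * a ^+ 2.
Proof.
move=> kn; pose s := grid a k; pose t := grid a k.+1.
have s0 : 0 <= s by exact: grid_ge0.
have st : s <= t by exact: grid_le.
have t0 : 0 <= t by exact: le_trans st.
have tn : t <= grid a n by exact: grid_le.
have ts : t - s = a ^+ 2 by exact: gridS.
have fe r : s <= r <= t -> `|X r w 0 i - X s w 0 i| <= e.
  move=> /andP[sr rt]; apply: me.
  - by rewrite (le_trans s0 sr) (le_trans rt tn).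
  - by rewrite s0 (le_trans st tn).
  - by rewrite ger0_norm ?subr_ge0// -ts lerD2r.
have := Rintegral_increment s0 st (@coord_within_continuous i) fe.
rewrite ts => H.
have -> : raw_drift B X sigma a k w i + theta * a ^+ 2 * X (grid a k) w 0 i =
  - theta * (\int[lebesgue_measure]_(r in [set` `[0, t]]) X r w 0 i
   - \int[lebesgue_measure]_(r in [set` `[0, s]]) X r w 0 i - a ^+ 2 * X s w 0 i).
  by rewrite /raw_drift /dB (eqX i t0) (eqX i s0) -/s -/t; ring.
rewrite normrM normrN (gtr0_norm theta0) -mulrA ler_wpM2l ?(ltW theta0)//.
by rewrite (mulrC e).
Qed.

(** The clipping level theta (L + 1) h is not exceeded: inside the ball a coordinate is at most L,
    which costs theta L h, and the oscillation e <= 1 over a cell costs at most theta h more. *)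
Lemma scheme_eq_path k : (k <= n)%N -> (forall j, (j < k)%N -> alivew a j) ->
  schemew a k = x (grid a k).
Proof.
elim: k => [|k IH] kn al_.
  by apply/funext => i; rewrite /= /grid mul0r.
have E : schemew a k = x (grid a k).
  by apply: IH => [|j jk]; [exact: ltnW|apply: al_; exact: ltnW].
have Hk : alivew a k by exact: al_.
apply/funext => i /=; move: (Hk); rewrite /alive => ->; rewrite E.
rewrite /drift clip_id; first by rewrite /raw_drift; ring.
have xL : `|X (grid a k) w 0 i| <= L.
  rewrite -(@ler_pXn2r _ 2)// ?nnegrE// real_normK ?num_real//.
  rewrite (le_trans _ l2L)// (le_trans _ (ltW Hk))//.
  by have := coord_le_sqn (schemew a k) i; rewrite {1}E.
have := path_increment i kn.
have th : 0 <= theta * a ^+ 2 by apply: mulr_ge0; exact: ltW.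
have h1 : `|theta * a ^+ 2 * X (grid a k) w 0 i| <= theta * a ^+ 2 * L.
  by rewrite normrM (ger0_norm th) ler_wpM2l.
have h2 : theta * e * a ^+ 2 <= theta * a ^+ 2 by rewrite mulrAC ler_piMr.
set v := theta * a ^+ 2 * X (grid a k) w 0 i in h1 *.
set u := raw_drift _ _ _ _ _ _ _ => h3.
rewrite -(addrK v u); apply: (le_trans (ler_normB _ _)).
rewrite (_ : c * a ^+ 2 = theta * a ^+ 2 + theta * a ^+ 2 * L); last by ring.
by rewrite lerD// (le_trans h3).
Qed.

Lemma alive_eq_path k : (k <= n)%N -> alivew a k -> schemew a k = x (grid a k).
Proof.
by move=> kn Hk; apply: scheme_eq_path => // j jk; apply: alive_le Hk; exact: ltnW.
Qed.

Lemma drift_error_le k : (k < n)%N -> errw a k <= d%:R * (theta * e * a ^+ 2).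
Proof.
move=> kn; rewrite /drift_error /alive_ind; case: (boolP (alivew a k)) => Hk; last first.
  have th : 0 <= theta * a ^+ 2 by apply: mulr_ge0; exact: ltW.
  by rewrite mul0r mulr_ge0// mulrAC mulr_ge0.
rewrite mul1r mulr_natl -[X in _ *+ X]card_ord -sumr_const; apply: ler_sum => i _.
have E := alive_eq_path (ltnW kn) Hk.
(* Here [kn] reads as [k.+1 <= n]: scheme and path agree at the next grid time too, so the clipped
   drift is the raw one. *)
have E1 := scheme_eq_path kn (fun j (jk : (j <= k)%N) => alive_le jk Hk).
have -> : drift B X sigma c a k w i = raw_drift B X sigma a k w i.
  have := congr1 (fun f => f i) E1 => /=; move: (Hk); rewrite /alive => ->.
  rewrite E => E1'; rewrite /raw_drift -E1'; ring.
by rewrite E; exact: path_increment.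
Qed.

(** The exit time of the scheme, truncated at the horizon. As a sum of indicators its mean can be
    compared term by term with the sum of the means of [alive_gen]. *)
Definition lifetime a n : R := a ^+ 2 * \sum_(k < n) alive_ind B X sigma l2 c a k w.

(** The scheme coincides with the path up to and including the exit step, so an exit of the scheme
    is an exit of [X] at a grid time. *)
Lemma lifetime_case :
  lifetime a n = grid a n \/
  exists k, [/\ (k < n)%N, lifetime a n = grid a k & l2 <= sqn (x (grid a k))].
Proof.
have [all_alive|] := pselect (forall k, (k < n)%N -> alivew a k).
  left; rewrite /lifetime /grid mulrC; congr (_ * _).
  rewrite (eq_bigr (fun=> 1)); first by rewrite sumr_const card_ord.
  by move=> k _; rewrite /alive_ind all_alive.
move=> /existsNP[k0 /not_implyP[k0n dk0]]; right.
have ex : exists k, (k < n)%N && ~~ alivew a k.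
  by exists k0; rewrite k0n; apply/negP.
have [k /andP[kn dk] kmin] := ex_minnP ex.
have alk j : (j < k)%N -> alivew a j.
  move=> jk; apply: contraT => dj; have := kmin j.
  by rewrite (ltn_trans jk kn) dj leqNgt jk => /(_ isT).
exists k; split => //; last first.
  by move: dk; rewrite /alive -leNgt scheme_eq_path// ltnW.
rewrite /lifetime /grid mulrC; congr (_ * _).
rewrite -(big_mkord xpredT (fun j => alive_ind B X sigma l2 c a j w)).
rewrite (big_cat_nat (n := k))//=; last exact: ltnW.
rewrite [X in X + _](@eq_big_nat _ _ _ _ _ _ (fun=> 1)); last first.
  by move=> j /andP[_ jk]; rewrite /alive_ind alk.
rewrite [X in _ + X](@eq_big_nat _ _ _ _ _ _ (fun=> 0)); last first.
  move=> j /andP[kj jn]; rewrite /alive_ind; case: (boolP (alivew a j)) => // /(alive_le kj).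
  by rewrite (negbTE dk).
by rewrite big1_eq addr0 sumr_const_nat subn0.
Qed.

Lemma lifetime_le_grid k : (k <= n)%N -> l2 <= sqn (x (grid a k)) ->
  lifetime a n <= grid a k.
Proof.
move=> kn lk.
have dk : ~~ alivew a k.
  apply/negP => Hk; move: (Hk); rewrite /alive alive_eq_path//.
  by rewrite ltNge lk.
rewrite /lifetime /grid mulrC ler_pM2r//.
rewrite -(big_mkord xpredT (fun j => alive_ind B X sigma l2 c a j w)).
rewrite (big_cat_nat (n := k))//=.
rewrite [X in _ + X](@eq_big_nat _ _ _ _ _ _ (fun=> 0)); last first.
  move=> j /andP[kj jn]; rewrite /alive_ind; case: (boolP (alivew a j)) => // /(alive_le kj).
  by rewrite (negbTE dk).
rewrite big1_eq addr0 big_mkord -[X in _ <= X%:R]card_ord -sumr_const.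
by apply: ler_sum => j _; rewrite /alive_ind; case: (alivew a j).
Qed.

End fixed_step.

Lemma lifetime_le a n : 0 <= lifetime a n <= grid a n.
Proof.
rewrite /lifetime /grid mulrC; have al01 k : 0 <= alw a k <= 1.
  by rewrite /alive_ind; case: (alivew a k); rewrite ler01 lexx.
apply/andP; split.
  by rewrite mulr_ge0 ?sqr_ge0// sumr_ge0// => k _; case/andP: (al01 k).
rewrite ler_wpM2r ?sqr_ge0// -[X in _ <= X%:R]card_ord -sumr_const.
by apply: ler_sum => k _; case/andP: (al01 k).
Qed.

End pathwise.

(** A time step is the square of this; [n.+1] of them fill [0, T] exactly. *)
Definition step (R : realType) (T : R) (n : nat) : R := Num.sqrt (T / n.+1%:R).

Section step.
Context {R : realType}.
Variable (T : R).
Hypothesis T0 : 0 < T.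

Lemma step_gt0 n : 0 < step T n.
Proof. by rewrite sqrtr_gt0 divr_gt0. Qed.

Lemma step_sqr n : step T n ^+ 2 = T / n.+1%:R.
Proof. by rewrite sqr_sqrtr// ltW// divr_gt0. Qed.

Lemma grid_step n : grid (step T n) n.+1 = T.
Proof. by rewrite /grid step_sqr mulrC divfK. Qed.

Lemma step_sqr_near (e : R) : 0 < e -> \forall n \near \oo, step T n ^+ 2 <= e.
Proof.
move=> e0.
have := @near_infty_natSinv_lt R (PosNum (divr_gt0 e0 T0)) => h.
near=> n; rewrite step_sqr mulrC -ler_pdivlMr//.
have : n.+1%:R^-1 < e / T by near: n; exact: h.
exact: ltW.
Unshelve. all: by end_near. Qed.

Lemma step_near (e : R) : 0 < e -> \forall n \near \oo, step T n <= e.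
Proof.
move=> e0; have := step_sqr_near (exprn_gt0 2 e0); apply: filterS => n h.
by rewrite -(@ler_pXn2r _ 2)// nnegrE ltW// step_gt0.
Qed.

End step.

Section pathwise_limit.
Context (disp : measure_display) (Omega : measurableType disp) (R : realType)
  (d : nat) (B X : R -> Omega -> 'rV[R]_d) (w : Omega).
Variables (sigma theta : R).
Hypotheses (theta0 : 0 < theta).
Hypothesis cX : {within [set` `[0, +oo[], continuous (fun t => X t w)}.
Hypothesis eqX : forall t (i : 'I_d), 0 <= t ->
    X t w 0 i = X 0 w 0 i
      - theta * (\int[lebesgue_measure]_(s in [set` `[0, t]]) X s w 0 i)
      + sigma * (B t w 0 i - B 0 w 0 i).
Variables (T : R) (T0 : 0 < T).

Lemma modulus_near e : 0 < e -> \forall n \near \oo, modulus X w (step T n) e T.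
Proof.
move=> e0.
have h : \forall delta \near 0^'+, forall i s t, 0 <= s <= T -> 0 <= t <= T ->
    `|s - t| <= delta -> `|X s w 0 i - X t w 0 i| <= e.
  apply: filter_forall => i.
  exact: (within_continuous_unif T (@coord_within_continuous _ _ _ _ X w cX i) e0).
have [delta [delta0 hd]] : exists delta, 0 < delta /\
    forall i s t, 0 <= s <= T -> 0 <= t <= T ->
    `|s - t| <= delta -> `|X s w 0 i - X t w 0 i| <= e.
  near (0 : R)^'+ => delta; exists delta; split.
    by near: delta; exact: nbhs_right_gt.
  by near: delta.
have := step_sqr_near T0 delta0; apply: filterS => n hn i s t hs ht st.
by apply: hd => //; exact: le_trans hn.
Unshelve. all: by end_near. Qed.

Section fixed_level.
Variables (l2 L : R).
Hypotheses (L0 : 0 <= L) (l2L : l2 <= L ^+ 2).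
Local Notation c := (theta * (L + 1)).
Local Notation errw a k := (drift_error B X sigma theta l2 c a k w).
Local Notation life n := (lifetime B X w sigma theta l2 L (step T n) n.+1).

Lemma lifetime_step_le n : 0 <= life n <= T.
Proof. by have := lifetime_le B X w sigma theta l2 L (step T n) n.+1; rewrite grid_step. Qed.

Lemma drift_error_cvg0 :
  (\sum_(k < n.+1) errw (step T n) k) @[n --> \oo] --> (0 : R).
Proof.
apply/cvgrPdist_le => e e0.
(* The n + 1 errors add up to at most d theta T e'. The minimum with 1 meets the condition under
   which the clipping is inactive. *)
pose e' := Num.min 1 (e / (d%:R * theta * T + 1)).
have D0 : 0 < d%:R * theta * T + 1.
  have tT : 0 <= theta * T by apply: mulr_ge0; exact: ltW.
  by rewrite ltr_wpDl// -mulrA mulr_ge0.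
have e'0 : 0 < e' by rewrite lt_min ltr01 divr_gt0.
have e'1 : e' <= 1 by rewrite ge_min lexx.
near=> n.
have me : modulus X w (step T n) e' (grid (step T n) n.+1).
  by rewrite grid_step//; near: n; exact: modulus_near.
have hk k : (k < n.+1)%N -> errw (step T n) k <= d%:R * (theta * e' * step T n ^+ 2).
  exact: (drift_error_le theta0 cX eqX L0 l2L (step_gt0 T0 n) (ltW e'0) e'1 me).
have e_ge0 k : 0 <= errw (step T n) k.
  by rewrite /drift_error; apply: mulr_ge0; [rewrite /alive_ind|apply: sumr_ge0].
rewrite sub0r normrN ger0_norm; last by apply: sumr_ge0.
apply: (@le_trans _ _ (\sum_(k < n.+1) d%:R * (theta * e' * step T n ^+ 2))).
  by apply: ler_sum => k _; exact: hk.
rewrite sumr_const card_ord step_sqr//.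
apply: (@le_trans _ _ (e' * (d%:R * theta * T))).
  rewrite -mulr_natr le_eqVlt; apply/orP; left; apply/eqP.
  by field; rewrite addrC natr1 pnatr_eq0.
apply: (@le_trans _ _ (e' * (d%:R * theta * T + 1))).
  by rewrite ler_wpM2l ?(ltW e'0)// lerDl.
by rewrite -ler_pdivlMr// ge_min lexx orbT.
Unshelve. all: by end_near. Qed.

End fixed_level.

Lemma sqn_continuous : {within [set` `[0, +oo[], continuous
  (fun t => sqn (fun i => X t w 0 i))}.
Proof.
move=> t; apply: cvg_big => [|i _]; first exact: add_continuous.
apply: (continuous_cvg _ (@exprn_continuous _ 2 _)).
exact: (@coord_within_continuous _ _ _ _ X w cX i t).
Qed.

(** By the intermediate value theorem a path that starts inside the closed ball and is on or outside
    the sphere at time [t] has hit the sphere by then. *)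
Lemma hitting_time_le (L t : R) : 0 <= L -> 0 <= t -> eucl_norm (X 0 w) <= L ->
  L ^+ 2 <= sqn (fun i => X t w 0 i) -> (hitting_time X L w <= t%:E)%E.
Proof.
move=> L0 t0 X0L Lt.
have cs : {within [set` `[0, t]], continuous (fun t => sqn (fun i => X t w 0 i))}.
  apply: continuous_subspaceW sqn_continuous => r /=.
  by rewrite !in_itv /= => /andP[-> _].
have X0L2 : sqn (fun i => X 0 w 0 i) <= L ^+ 2.
  have -> : sqn (fun i => X 0 w 0 i) = eucl_norm (X 0 w) ^+ 2.
    by rewrite sqr_sqrtr ?sqn_ge0//; exact: sqn_ge0.
  by rewrite lerXn2r ?nnegrE// sqrtr_ge0.
have [r rt Er] : exists2 r, r \in `[0, t] & sqn (fun i => X r w 0 i) = L ^+ 2.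
  apply: (IVT t0 cs).
  by rewrite ge_min X0L2 /= le_max Lt orbT.
have /andP[r0 rt'] : 0 <= r <= t by move: rt; rewrite in_itv.
apply: (@le_trans _ _ r%:E); last by rewrite lee_fin.
apply: ereal_inf_lbound; exists r => //; split => //.
by rewrite /eucl_norm [X in Num.sqrt X]Er sqrtr_sqr ger0_norm.
Qed.

Lemma hitting_time_le_lifetime (L : R) : 0 <= L -> eucl_norm (X 0 w) <= L ->
  \forall n \near \oo,
    (Order.min (hitting_time X L w) T%:E <=
     (lifetime B X w sigma theta (L ^+ 2) L (step T n) n.+1)%:E)%E.
Proof.
move=> L0 X0L.
near=> n.
have me : modulus X w (step T n) 1 (grid (step T n) n.+1).
  by rewrite grid_step//; near: n; exact: modulus_near.
have [->|[k [kn -> Lk]]] := lifetime_case theta0 cX eqX L0 (lexx _) (step_gt0 T0 n)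
    (lexx _) me.
  by rewrite grid_step// ge_min lexx orbT.
rewrite ge_min hitting_time_le//; exact: grid_ge0 (step_gt0 T0 n) k.
Unshelve. all: by end_near. Qed.

(** The last grid point before [t] is close to a point of the sphere, so for a fine mesh it lies
    outside the strictly smaller ball and the scheme has already stopped. If t >= T the bound by the
    horizon is enough. *)
Lemma lifetime_le_hitting (l2 L t : R) : 0 <= L -> l2 < L ^+ 2 -> 0 <= t ->
  eucl_norm (X t w) = L ->
  \forall n \near \oo, lifetime B X w sigma theta l2 L (step T n) n.+1 <= t.
Proof.
move=> L0 l2L t0 XtL.
have [Tt|tT] := leP T t.
  by near=> n; apply: le_trans Tt; have /andP[] := lifetime_step_le l2 L n.
have L2 : sqn (fun i => X t w 0 i) = L ^+ 2.
  by rewrite -XtL sqr_sqrtr//; exact: sqn_ge0.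
(* Chosen so that d e (2L + 1) <= L^2 - l2; the factor 2L + 1 bounds |u + v| for |u| <= L and |u -
   v| <= 1. *)
pose e := Num.min 1 ((L ^+ 2 - l2) / (d%:R * (2 * L + 1) + 1)).
have D0 : 0 < d%:R * (2 * L + 1) + 1.
  by rewrite ltr_wpDl// mulr_ge0// addr_ge0// mulr_ge0.
have e0 : 0 < e by rewrite lt_min ltr01 divr_gt0// subr_gt0.
have e1 : e <= 1 by rewrite ge_min lexx.
near=> n.
have me : modulus X w (step T n) e (grid (step T n) n.+1).
  by rewrite grid_step//; near: n; exact: modulus_near.
pose h := step T n ^+ 2; have h0 : 0 < h by rewrite exprn_gt0// step_gt0.
pose k := Num.truncn (t / h).
have /andP[kt tk] : k%:R <= t / h < k.+1%:R.
  by apply: truncn_itv; rewrite divr_ge0// ltW.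
have gk : grid (step T n) k <= t by rewrite /grid -ler_pdivlMr.
have gk1 : t < grid (step T n) k.+1 by rewrite /grid -ltr_pdivrMr.
have kn : (k <= n.+1)%N.
  rewrite -(ler_nat R) -(@ler_pM2r _ h)//; apply: (le_trans gk).
  by have := grid_step T0 n; rewrite /grid -/h => ->; exact: ltW.
have hi i : `|X t w 0 i - X (grid (step T n) k) w 0 i| <= e.
  apply: me.
  - by rewrite t0 grid_step// ltW.
  - by rewrite grid_ge0 ?step_gt0// grid_step//= (le_trans gk)// ltW.
  - rewrite ger0_norm ?subr_ge0// lerBlDr (le_trans (ltW gk1))//.
    by have := gridS (step T n) k; rewrite -/h => /eqP; rewrite subr_eq => /eqP <-.
apply: (le_trans _ gk).
apply: (lifetime_le_grid theta0 cX eqX L0 (ltW l2L) (step_gt0 T0 n) e1 me kn).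
have xtL i : `|X t w 0 i| <= L.
  rewrite -(@ler_pXn2r _ 2)// ?nnegrE// real_normK ?num_real// -L2.
  exact: (coord_le_sqn (fun i => X t w 0 i) i).
have : L ^+ 2 - sqn (fun i => X (grid (step T n) k) w 0 i) <= d%:R * (e * (2 * L + 1)).
  rewrite -L2 /sqn -sumrB mulr_natl -[X in _ *+ X]card_ord -sumr_const.
  apply: ler_sum => i _; rewrite subr_sqr; apply: (le_trans (ler_norm _)).
  rewrite normrM; apply: ler_pM => //.
  have := hi i; have := xtL i; rewrite !ler_norml => /andP[? ?] /andP[? ?].
  by apply/andP; split; lra.
have : d%:R * (e * (2 * L + 1)) <= L ^+ 2 - l2.
  apply: (@le_trans _ _ (e * (d%:R * (2 * L + 1) + 1))).
    by rewrite mulrCA ler_wpM2l ?(ltW e0)// lerDl.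
  by rewrite -ler_pdivlMr// ge_min lexx orbT.
by lra.
Unshelve. all: by end_near. Qed.

End pathwise_limit.

(** * Bounds on the expected hitting time *)

Section limn_einf_near.
Local Open Scope ereal_scope.
Context {R : realType}.
Implicit Types (u : (\bar R)^nat) (b : \bar R).

Lemma limn_einfE u : limn_einf u = ereal_sup (range (einfs u)).
Proof. by rewrite limn_einf_lim; apply/cvg_lim => //; exact: cvg_einfs_sup. Qed.

Lemma near_le_limn_einf u b :
  (\forall n \near \oo, b <= u n) -> b <= limn_einf u.
Proof.
move=> [N _ hN]; rewrite limn_einfE; apply: (@le_trans _ _ (einfs u N)).
  by apply: le_ereal_inf_tmp => _ [n /= Nn <-]; exact: hN.
by apply: ereal_sup_ubound; exists N.
Qed.

Lemma near_limn_einf_le u b :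
  (\forall n \near \oo, u n <= b) -> limn_einf u <= b.
Proof.
move=> [N _ hN]; rewrite limn_einfE; apply: ge_ereal_sup => _ [m _ <-].
apply: (@le_trans _ _ (u (maxn m N))).
  by apply: ereal_inf_lbound; exists (maxn m N) => //=; rewrite leq_maxl.
by apply: hN; rewrite /= leq_maxr.
Qed.

End limn_einf_near.

Section lower_integral.
Context (disp : measure_display) (T : measurableType disp) (R : realType)
  (P : probability T R).

Import HBNNSimple.

(* [g] need not be measurable: its integral is then a lower integral. *)
Lemma integral_le_simple (g : T -> \bar R) (U : \bar R) :
  (forall w, 0 <= g w)%E ->
  (forall s : {nnsfun T >-> R}, (forall w, (s w)%:E <= g w)%E ->
     (\int[P]_w (s w)%:E <= U)%E) ->
  (\int[P]_w g w <= U)%E.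
Proof.
move=> g0 hs; rewrite ge0_integralTE//; apply: ge_ereal_sup => _ [s sg <-].
by rewrite -integralT_nnsfun; exact: hs.
Qed.

(** Both integrals are suprema over simple functions below the integrand. *)
Lemma le_integral_lower (f g : T -> \bar R) :
  (forall w, 0 <= f w)%E -> (forall w, f w <= g w)%E ->
  (\int[P]_w f w <= \int[P]_w g w)%E.
Proof.
move=> f0 fg; have g0 w : (0 <= g w)%E by exact: le_trans (fg w).
rewrite !ge0_integralTE//; apply: ge_ereal_sup => _ [s sf <-].
by apply: ereal_sup_ubound; exists s => // w; exact: le_trans (fg w).
Qed.

(** [F] is the pointwise lower limit: Fatou's lemma bounds its mean, and any eventual lower bound of
    the sequence passes to it. *)
Lemma bounded_fatou (f : nat -> T -> R) (b V : R) :
  (forall n, measurable_fun setT (f n)) ->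
  (forall n w, 0 <= f n w <= b) ->
  (\forall n \near \oo, mean P (f n) <= V) ->
  exists F : T -> R, [/\ measurable_fun setT F, forall w, 0 <= F w <= b,
    mean P F <= V &
    forall w y, (\forall n \near \oo, y <= f n w) -> y <= F w].
Proof.
move=> mf fb hV.
pose G w := limn_einf (fun n => (f n w)%:E).
have mf' n : measurable_fun setT (fun w => (f n w)%:E : \bar R).
  exact/measurable_EFinP.
have G0 w : (0 <= G w)%E.
  apply: near_le_limn_einf; apply: nearW => n.
  by rewrite lee_fin; case/andP: (fb n w).
have Gb w : (G w <= b%:E)%E.
  apply: near_limn_einf_le; apply: nearW => n.
  by rewrite lee_fin; case/andP: (fb n w).
have Gfin w : G w \is a fin_num.
  by rewrite ge0_fin_numE// (le_lt_trans (Gb w))// ltry.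
have mG : measurable_fun setT G.
  rewrite (_ : G = fun w => (- limn_esup (fun n => - (f n w)%:E))%E)//.
  apply: measurableT_comp => //; apply: measurable_fun_limn_esup => n.
  exact: measurableT_comp.
have mF : measurable_fun setT (fine \o G) by exact: measurableT_comp.
have Fb w : 0 <= fine (G w) <= b by rewrite fine_ge0// -lee_fin fineK// Gb.
have If (g : T -> R) : measurable_fun setT g -> (forall w, 0 <= g w <= b) -> finite_mean P g.
  move=> mg gb; apply: (@finite_mean_bounded _ _ _ _ _ b) => // w.
  by have /andP[? ?] := gb w; rewrite ger0_norm.
exists (fine \o G); split => //.
- rewrite -lee_fin -meanE; last exact: If.
  under eq_integral do rewrite /= fineK//.
  apply: (le_trans (fatou P measurableT mf' _)).
    by move=> n w _; rewrite lee_fin; case/andP: (fb n w).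
  apply: near_limn_einf_le; apply: filterS hV => n hn.
  by rewrite meanE ?lee_fin//; exact: If.
- move=> w y hy; rewrite -lee_fin /= fineK//.
  by apply: near_le_limn_einf; apply: filterS hy => n; rewrite lee_fin.
Qed.

End lower_integral.

Section mean_lifetime.
Context (disp : measure_display) (Omega : measurableType disp) (R : realType)
  (P : probability Omega R) (d : nat) (hd : (0 < d)%N)
  (B X : R -> Omega -> 'rV[R]_d).
Variables (sigma theta x : R).
Hypotheses (sigma0 : 0 < sigma) (theta0 : 0 < theta).
Hypothesis hB : standard_BM P B.
Hypothesis hindep : independent2 P (sigma_process [set 0] X)
                                   (sigma_process [set t | 0 <= t] B).
Hypothesis hX : OU_strong_solution P theta sigma B X.
Hypothesis hX0 : \forall w \ae P, eucl_norm (X 0 w) = x.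

Let mX := ou_measurable hX.
Let adX := ou_adapted hX.

Definition regular (w : Omega) : Prop :=
  [/\ {within [set` `[0, +oo[], continuous (fun t => X t w)},
      forall t (i : 'I_d), 0 <= t -> X t w 0 i = X 0 w 0 i
        - theta * (\int[lebesgue_measure]_(s in [set` `[0, t]]) X s w 0 i)
        + sigma * (B t w 0 i - B 0 w 0 i)
    & eucl_norm (X 0 w) = x].

Lemma regular_ae : {ae P, forall w, regular w}.
Proof.
have h1 := ou_continuous hX; have h2 := ou_equation hX.
by apply: filterS3 h1 h2 hX0 => w c1 e1 n1; split.
Qed.

Variables (l2 L : R).
Hypotheses (l20 : 0 <= l2) (L0 : 0 <= L) (l2L : l2 <= L ^+ 2).
Local Notation c := (theta * (L + 1)).
Let c0 : 0 <= c. Proof. by rewrite mulr_ge0 ?(ltW theta0)// addr_ge0. Qed.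

Section horizon.
Variable T : R.
Hypothesis T0 : 0 < T.
Let st0 n : 0 < step T n. Proof. exact: step_gt0. Qed.

Local Notation err n k := (drift_error B X sigma theta l2 c (step T n) k).
Local Notation life n := (fun w => lifetime B X w sigma theta l2 L (step T n) n.+1).

Lemma lifetime_measurable n : measurable_fun setT (life n).
Proof.
apply: measurable_funM => //; apply: measurable_sum => k.
exact: (alive_ind_measurable hd hB mX adX).
Qed.

Lemma finite_mean_lifetime n : finite_mean P (life n).
Proof.
apply: (@finite_mean_bounded _ _ _ _ _ T); first exact: lifetime_measurable.
move=> w; have /andP[h1 h2] := lifetime_step_le B X w sigma theta T0 l2 L n.
by rewrite ger0_norm.
Qed.

(** Dominated convergence on regular paths: n + 1 errors of order T / (n + 1) have a constant
    majorant. *)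
Lemma mean_drift_error_cvg0 :
  (\sum_(k < n.+1) mean P (err n k)) @[n --> \oo] --> (0 : R).
Proof.
pose f n w := \sum_(k < n.+1) err n k w.
pose b := d%:R * (c + theta * (1 + l2)) * T.
have Ierr n k : finite_mean P (err n k).
  exact: (finite_mean_drift_error hd hB mX adX sigma theta0 l20 c0).
have fb n w : 0 <= f n w <= b.
  have h k := drift_error_bound B X sigma theta0 l20 c0 (step T n) k w.
  apply/andP; split; first by apply: sumr_ge0 => k _; case/andP: (h k).
  apply: (@le_trans _ _ (\sum_(k < n.+1) (d%:R * (c + theta * (1 + l2)) * step T n ^+ 2))).
    by apply: ler_sum => k _; case/andP: (h k).
  rewrite sumr_const card_ord step_sqr// -mulr_natr le_eqVlt; apply/orP; left.
  by apply/eqP; rewrite /b; field; rewrite addrC natr1 pnatr_eq0.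
have mf n : measurable_fun setT (f n).
  by apply: measurable_sum => k; exact: (drift_error_measurable hd hB mX adX).
have [] := @dominated_convergence _ _ _ P setT measurableT
  (fun n w => (f n w)%:E) (cst 0%E) (cst b%:E).
- by move=> n; exact/measurable_EFinP.
- exact: measurable_cst.
- apply: filterS regular_ae => w [cw ew _] _.
  apply/fine_cvgP; split; first exact: nearW.
  exact: (drift_error_cvg0 theta0 cw ew T0 L0 l2L).
- exact: finite_measure_integrable_cst.
- apply: nearW => w n _ /=; have /andP[h1 h2] := fb n w.
  by rewrite lee_fin ger0_norm.
move=> _ _; rewrite integral_cst// mul0e => /fine_cvgP[_ h].
rewrite [X in X @ _ --> _](_ : _ = (fun n => fine (\int[P]_w (f n w)%:E)))//.
apply/funext => n; rewrite -[RHS]/(mean P (f n)) mean_sum// => k _.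
Qed.

Section lyapunov.
Variables (alpha beta mu M : R).
Hypotheses (alpha0 : 0 <= alpha) (beta0 : 0 <= beta) (mu0 : 0 <= mu)
  (lM : l2 < M) (xM : x ^+ 2 <= M).

Local Notation g := (lyap alpha beta mu).
Local Notation gen := (generator d alpha beta mu sigma theta).
Local Notation cap n k := (capped B X sigma l2 c alpha beta mu M (step T n) k).
Local Notation ag n k := (alive_gen B X sigma theta l2 c alpha beta mu (step T n) k).

Lemma sqn_eucl_norm (v : 'rV[R]_d) : sqn (fun i => v 0 i) = eucl_norm v ^+ 2.
Proof. by rewrite sqr_sqrtr//; exact: sqn_ge0. Qed.

Lemma mean_capped0 n : mean P (cap n 0%N) = g (x ^+ 2).
Proof.
rewrite -(mean_cst P (g (x ^+ 2))); congr fine.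
apply: ae_eq_integral => //.
- have := finite_mean_capped hd hB mX adX sigma c l20 alpha0 beta0 mu0 lM 0 (st0 n).
  exact: measurable_int.
- apply: filterS hX0 => w hw _; rewrite /capped /= sqn_eucl_norm hw.
  by rewrite min_l.
Qed.

(** Dynkin's formula for the scheme up to [e]: half of [e] pays for the drift errors, half for the
    Taylor errors T a. *)
Lemma dynkin_near (e : R) : 0 < e -> \forall n \near \oo,
  `|mean P (cap n n.+1) - g (x ^+ 2)
      - step T n ^+ 2 * \sum_(k < n.+1) mean P (ag n k)| <= e.
Proof.
move=> e0.
have [K [K0 HK]] := scheme_estimate hd hB hindep mX adX sigma0 theta0 l20 c0
  alpha0 beta0 mu0 lM.
have K1 : 0 < K + 1 by rewrite ltr_wpDl.
have e20 : 0 < e / (2 * (K + 1)) by rewrite divr_gt0// mulr_gt0.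
have eT0 : 0 < e / (2 * (K + 1) * T) by rewrite divr_gt0// !mulr_gt0.
near=> n.
rewrite -(mean_capped0 n); apply: (le_trans (HK _ _ (st0 n) _)).
  by near: n; exact: step_near.
have h1 : \sum_(k < n.+1) mean P (err n k) <= e / (2 * (K + 1)).
  apply: (le_trans (ler_norm _)).
  near: n; have /cvgrPdist_le/(_ _ e20) := mean_drift_error_cvg0.
  by apply: filterS => n; rewrite sub0r normrN.
have h2 : n.+1%:R * step T n ^+ 3 <= e / (2 * (K + 1)).
  rewrite exprS step_sqr// mulrCA (mulrC n.+1%:R) divfK ?pnatr_eq0//.
  rewrite -ler_pdivlMr// -mulrA -invfM.
  by near: n; exact: step_near.
apply: (@le_trans _ _ ((K + 1) * (e / (2 * (K + 1)) + e / (2 * (K + 1))))).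
  apply: ler_pM => //; last exact: lerD.
    rewrite addr_ge0//; last by rewrite mulr_ge0// exprn_ge0// ltW.
    apply: sumr_ge0 => k _; rewrite -(mean_cst P 0); apply: le_mean.
    + exact: finite_mean_cst.
    + exact: (finite_mean_drift_error hd hB mX adX sigma theta0 l20 c0).
    + by move=> w; case/andP: (drift_error_bound B X sigma theta0 l20 c0 (step T n) k w).
  by rewrite lerDl.
rewrite le_eqVlt; apply/orP; left; apply/eqP; field.
by rewrite gt_eqF.
Unshelve. all: by end_near. Qed.

Lemma mean_lifetimeE n :
  mean P (life n) = step T n ^+ 2 * \sum_(k < n.+1) mean P (alive_ind B X sigma l2 c (step T n) k).
Proof.
rewrite /lifetime meanZ.
  by rewrite mean_sum// => k _; exact: (finite_mean_alive_ind hd hB mX adX).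
by apply: finite_mean_sum => k _; exact: (finite_mean_alive_ind hd hB mX adX).
Qed.

Let Ial n k : finite_mean P (alive_ind B X sigma l2 c (step T n) k).
Proof. exact: (finite_mean_alive_ind hd hB mX adX). Qed.

Let Iag n k : finite_mean P (ag n k).
Proof. exact: (finite_mean_alive_gen hd hB mX adX sigma theta0 c l20 alpha0 beta0 mu0). Qed.

(** On live states G >= 1, so the accumulated drift dominates the lifetime, while the capped
    terminal value is at most g(M). *)
Lemma mean_lifetime_le (e : R) : 0 < e ->
  (forall r, 0 <= r -> r < l2 -> 1 <= gen r) ->
  \forall n \near \oo, mean P (life n) <= g M - g (x ^+ 2) + e.
Proof.
move=> e0 gen1; apply: filterS (dynkin_near e0) => n.
rewrite ler_norml => /andP[h1 _].
have h2 : mean P (cap n n.+1) <= g M.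
  rewrite -(mean_cst P (g M)); apply: le_mean; last 1 first.
  - by move=> w; case/andP: (capped_bound B X sigma c l20 alpha0 beta0 mu0 lM (step T n) n.+1 w).
  - exact: (finite_mean_capped hd hB mX adX sigma c l20 alpha0 beta0 mu0 lM).
  - exact: finite_mean_cst.
have h3 : mean P (life n) <= step T n ^+ 2 * \sum_(k < n.+1) mean P (ag n k).
  rewrite mean_lifetimeE ler_wpM2l ?sqr_ge0//; apply: ler_sum => k _.
  apply: le_mean => // w; rewrite /alive_gen /alive_ind.
  case: (boolP (alive B X sigma l2 c (step T n) k w)) => Hw; last by rewrite mul0r.
  by rewrite mul1r gen1// sqn_ge0.
lra.
Qed.

(* The capped process at time [T] is at least [g l2] once the scheme has left the
   ball, and by Markov's inequality it is still inside with probability at most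
   [mean P (life n) / T]. *)
Lemma mean_lifetime_ge (e : R) : 0 < e ->
  (forall r, 0 <= r -> r < l2 -> gen r <= 1) ->
  \forall n \near \oo, g l2 - g (x ^+ 2) - e <= mean P (life n) * (1 + g l2 / T).
Proof.
move=> e0 gen1; apply: filterS (dynkin_near e0) => n.
rewrite ler_norml => /andP[_ h1].
have gl0 : 0 <= g l2 by exact: lyap_ge0.
have h2 : g l2 - g l2 / T * mean P (life n) <= mean P (cap n n.+1).
  rewrite -{1}(mean_cst P (g l2)) -meanZ; last exact: finite_mean_lifetime.
  rewrite -meanB; [|exact: finite_mean_cst|exact/finite_meanZ/finite_mean_lifetime].
  apply: le_mean.
  - apply: finite_meanB; first exact: finite_mean_cst.
    exact/finite_meanZ/finite_mean_lifetime.
  - exact: (finite_mean_capped hd hB mX adX sigma c l20 alpha0 beta0 mu0 lM).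
  - move=> w.
    case: (boolP (alive B X sigma l2 c (step T n) n.+1 w)) => Hw.
      have -> : lifetime B X w sigma theta l2 L (step T n) n.+1 = T.
        rewrite /lifetime (eq_bigr (fun=> 1)).
          by rewrite sumr_const card_ord mulrC; exact: grid_step.
        move=> k _; rewrite /alive_ind (@alive_le _ _ _ _ B X w sigma theta l2 L (step T n) k n.+1)//.
        exact/ltnW.
      rewrite divfK ?gt_eqF// subrr.
      by case/andP: (capped_bound B X sigma c l20 alpha0 beta0 mu0 lM (step T n) n.+1 w).
    have /andP[lf0 _] := lifetime_step_le B X w sigma theta T0 l2 L n.
    apply: (@le_trans _ _ (g l2)).
      by rewrite gerBl mulr_ge0// divr_ge0// ltW.
    apply: lyap_le => //; rewrite le_min (ltW lM) andbT.
    by rewrite leNgt; exact: Hw.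
have h3 : step T n ^+ 2 * \sum_(k < n.+1) mean P (ag n k) <= mean P (life n).
  rewrite mean_lifetimeE ler_wpM2l ?sqr_ge0//; apply: ler_sum => k _.
  apply: le_mean => // w; rewrite /alive_gen /alive_ind.
  case: (boolP (alive B X sigma l2 c (step T n) k w)) => Hw; last by rewrite mul0r.
  by rewrite mul1r gen1// sqn_ge0.
rewrite mulrDr mulr1 (mulrC (mean _ _) (_ / T)); lra.
Qed.

End lyapunov.
End horizon.
End mean_lifetime.

Lemma lyap_cvg (R : realType) (alpha beta mu r : R) :
  lyap alpha beta mu y @[y --> r] --> lyap alpha beta mu r.
Proof.
apply: cvgD; apply: cvgMr => //.
apply: continuous_cvg; first exact: continuous_expR.
exact: cvgMr.
Qed.

Section expected_hitting_time.
Import HBNNSimple.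
Context (disp : measure_display) (Omega : measurableType disp) (R : realType)
  (P : probability Omega R) (d : nat) (hd : (0 < d)%N)
  (B X : R -> Omega -> 'rV[R]_d).
Variables (sigma theta x L : R).
Hypotheses (sigma0 : 0 < sigma) (theta0 : 0 < theta) (L0 : 0 < L) (x0 : 0 <= x)
  (xL : x <= L).
Hypothesis hB : standard_BM P B.
Hypothesis hindep : independent2 P (sigma_process [set 0] X)
                                   (sigma_process [set t | 0 <= t] B).
Hypothesis hX : OU_strong_solution P theta sigma B X.
Hypothesis hX0 : \forall w \ae P, eucl_norm (X 0 w) = x.

Variables (alpha beta mu : R).
Hypotheses (alpha0 : 0 <= alpha) (beta0 : 0 <= beta) (mu0 : 0 <= mu).
Local Notation g := (lyap alpha beta mu).
Local Notation gen := (generator d alpha beta mu sigma theta).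
Local Notation life T l2 n :=
  (fun w => lifetime B X w sigma theta l2 L (step T n) n.+1).

Let L20 : 0 <= L ^+ 2. Proof. exact: sqr_ge0. Qed.
Let xL2 : x ^+ 2 <= L ^+ 2. Proof. by rewrite lerXn2r ?nnegrE// ltW. Qed.

Lemma hitting_time_ge0 w : (0 <= hitting_time X L w)%E.
Proof. by apply: le_ereal_inf_tmp => _ [t [t0 _] <-]; rewrite lee_fin. Qed.

Lemma finite_mean_itv (f : Omega -> R) (b : R) : measurable_fun setT f ->
  (forall w, 0 <= f w <= b) -> finite_mean P f.
Proof.
move=> mf fb; apply: (@finite_mean_bounded _ _ _ _ _ b) => // w.
by have /andP[? ?] := fb w; rewrite ger0_norm.
Qed.

Lemma expected_hitting_time_le_near (M e : R) : L ^+ 2 < M -> 0 < e ->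
  (forall r, 0 <= r -> r < L ^+ 2 -> 1 <= gen r) ->
  (expected_hitting_time P X L <= (g M - g (x ^+ 2) + e)%:E)%E.
Proof.
move=> LM e0 gen1; apply: integral_le_simple; first exact: hitting_time_ge0.
move=> s s_tau.
(* A simple function is bounded; a horizon above its values puts [s] below min(tau, T), which the
   lifetimes eventually dominate. *)
have [T T0 sT] : exists2 T, 0 < T & forall w, s w <= T.
  have [M0 [_ hM]] := simple_bounded s.
  exists (`|M0| + 1) => [|w]; first by rewrite ltr_wpDl.
  apply: (le_trans (ler_norm _)); apply: (hM (`|M0| + 1)) => //.
  by rewrite ltr_pwDr// ler_norm.
have nearV := mean_lifetime_le hd sigma0 theta0 hB hindep hX hX0 L20 (ltW L0)
  (lexx _) T0 alpha0 beta0 mu0 LM (le_trans xL2 (ltW LM)) e0 gen1.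
have mlife n : measurable_fun setT (life T (L ^+ 2) n).
  exact: (lifetime_measurable hd hB hX).
have [F [mF Fb FV Fl]] := bounded_fatou mlife
  (fun n w => lifetime_step_le B X w sigma theta T0 (L ^+ 2) L n) nearV.
apply: (@le_trans _ _ (\int[P]_w (F w)%:E)%E); last first.
  by rewrite meanE ?lee_fin//; exact: finite_mean_itv Fb.
apply: ae_ge0_le_integral => //.
- by move=> w _; rewrite lee_fin.
- exact/measurable_EFinP.
- by move=> w _; rewrite lee_fin; case/andP: (Fb w).
- exact/measurable_EFinP.
apply: filterS (regular_ae hX hX0) => w [cw ew nw] _; rewrite lee_fin.
apply: Fl.
have := hitting_time_le_lifetime theta0 cw ew T0 (ltW L0).
rewrite nw => /(_ xL); apply: filterS => n h.
by rewrite -lee_fin; apply: le_trans h; rewrite le_min s_tau lee_fin sT.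
Qed.

Lemma expected_hitting_time_le :
  (forall r, 0 <= r -> r < L ^+ 2 -> 1 <= gen r) ->
  (expected_hitting_time P X L <= (g (L ^+ 2) - g (x ^+ 2))%:E)%E.
Proof.
move=> gen1; apply/lee_addgt0Pr => e e0.
have e20 : 0 < e / 2 by rewrite divr_gt0.
have h := cvg_at_right_filter (@lyap_cvg R alpha beta mu (L ^+ 2)).
have lt_e : g (L ^+ 2) < g (L ^+ 2) + e / 2 by rewrite ltrDl.
have hlt := cvgr_lt _ h _ lt_e.
near (L ^+ 2)^'+ => M.
have LM : L ^+ 2 < M by near: M; exact: nbhs_right_gt.
apply: (le_trans (expected_hitting_time_le_near LM e20 gen1)).
rewrite -EFinD lee_fin.
have : g M < g (L ^+ 2) + e / 2 by near: M; exact: hlt.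
lra.
Unshelve. all: by end_near. Qed.

Lemma expected_hitting_time_ge_near (l2 T e : R) :
  0 <= l2 -> l2 < L ^+ 2 -> 0 < T -> 0 < e ->
  (forall r, 0 <= r -> r < l2 -> gen r <= 1) ->
  (((g l2 - g (x ^+ 2) - e) / (1 + g l2 / T))%:E <= expected_hitting_time P X L)%E.
Proof.
move=> l20 l2L T0 e0 gen1; set V := (_ / _).
have gl0 : 0 <= g l2 by exact: lyap_ge0.
have D0 : 0 < 1 + g l2 / T by rewrite ltr_pwDl// divr_ge0// ltW.
have nearV := mean_lifetime_ge hd sigma0 theta0 hB hindep hX hX0 l20 (ltW L0)
  (ltW l2L) T0 alpha0 beta0 mu0 l2L xL2 e0 gen1.
have mlife n : measurable_fun setT (life T l2 n).
  exact: (lifetime_measurable hd hB hX).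
have lifeb n w := lifetime_step_le B X w sigma theta T0 l2 L n.
have Ilife n := finite_mean_lifetime hd hB hX l2 L T0 n.
(* Complementary times turn eventual upper bounds on the lifetimes into lower bounds, which pass to
   the lower limit [F]; hence T - F stays below the hitting time on regular paths. *)
have mf n : measurable_fun setT (fun w => T - life T l2 n w).
  by apply: measurable_funB => //; exact: mlife.
have fb n w : 0 <= T - life T l2 n w <= T.
  by have /andP[h1 h2] := lifeb n w; rewrite subr_ge0 h2 gerBl.
have hV : \forall n \near \oo, mean P (fun w => T - life T l2 n w) <= T - V.
  apply: filterS nearV => n h.
  rewrite meanB//; last exact: finite_mean_cst.
  by rewrite mean_cst lerD2l lerN2 ler_pdivrMr.
have [F [mF Fb FV Fl]] := bounded_fatou mf fb hV.
have IF : finite_mean P F by exact: finite_mean_itv Fb.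
have [N [mN PN0 subN]] := regular_ae hX hX0.
(* Setting the minorant to 0 on the measurable null set [N] makes it lie below the hitting time
   everywhere, not just almost everywhere. *)
pose q w := (T - F w) * \1_(~` N) w.
have mq : measurable_fun setT q.
  apply: measurable_funM; first exact: measurable_funB.
  exact/measurable_indic/measurableC.
have q0 w : 0 <= q w.
  by rewrite mulr_ge0// subr_ge0; case/andP: (Fb w).
apply: (@le_trans _ _ (\int[P]_w (q w)%:E)%E); last first.
  apply: le_integral_lower => w; first by rewrite lee_fin.
  rewrite /q indicE; case: (boolP (w \in ~` N)); last first.
    by rewrite mulr0 hitting_time_ge0.
  rewrite inE mulr1 => Nw.
  have [cw ew nw] : regular B X sigma theta x w.
    by apply: contrapT => rw; exact/Nw/subN.
  apply: le_ereal_inf_tmp => _ [t [t0 Xt] <-]; rewrite lee_fin lerBlDl -lerBlDr.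
  apply: Fl; have := lifetime_le_hitting theta0 cw ew T0 (ltW L0) l2L t0 Xt.
  by apply: filterS => n; rewrite lerD2l lerN2.
have -> : (\int[P]_w (q w)%:E = \int[P]_w (T - F w)%:E)%E.
  apply: ae_eq_integral => //; [exact/measurable_EFinP| |].
    by apply/measurable_EFinP; exact: measurable_funB.
  exists N; split => // w /= /not_implyP[_ qw]; apply: contrapT => Nw; apply: qw.
  by rewrite /q indicE mem_set ?mulr1.
rewrite meanE; last by apply: finite_meanB => //; exact: finite_mean_cst.
rewrite lee_fin meanB//; last exact: finite_mean_cst.
by rewrite mean_cst; lra.
Qed.

Lemma le_div_eq0 (a b : R) : 0 <= b -> (forall T, 0 < T -> a <= b / T) -> a <= 0.
Proof.
move=> b0 h; rewrite leNgt; apply/negP => a0.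
have := h _ (divr_gt0 (ltr_wpDl b0 ltr01) a0).
have b1 : 0 < b + 1 by rewrite ltr_wpDl.
rewrite invf_div mulrA ler_pdivlMr// mulrC mulrDl mul1r (mulrC b).
by rewrite gerDl leNgt a0.
Qed.

(** Only a finite expectation E needs an argument. Then the factor 1 + g(l2)/T can be multiplied
    out, T sent to infinity, and a gap at L^2 would by continuity persist at some l2 < L^2. *)
Lemma expected_hitting_time_ge :
  (forall r, 0 <= r -> r < L ^+ 2 -> gen r <= 1) ->
  ((g (L ^+ 2) - g (x ^+ 2))%:E <= expected_hitting_time P X L)%E.
Proof.
move=> gen1.
have Etau0 : (0 <= expected_hitting_time P X L)%E.
  by apply: integral_ge0 => w _; exact: hitting_time_ge0.
have := expected_hitting_time_ge_near; move: Etau0.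
case: (expected_hitting_time P X L) => [E| |] // E0 hE; last by rewrite leey.
rewrite lee_fin leNgt; apply/negP => gE; rewrite lee_fin in E0.
have hl l2 e : 0 <= l2 -> l2 < L ^+ 2 -> 0 < e -> g l2 - g (x ^+ 2) - e <= E.
  move=> l20 l2L e0; rewrite -subr_le0.
  have gl0 : 0 <= g l2 by exact: lyap_ge0.
  apply: (@le_div_eq0 _ (E * g l2)) => [|T T0]; first exact: mulr_ge0.
  have D0 : 0 < 1 + g l2 / T by rewrite ltr_pwDl// divr_ge0// ltW.
  have := hE l2 T e l20 l2L T0 e0 (fun r r0 rl => gen1 r r0 (lt_trans rl l2L)).
  by rewrite lee_fin ler_pdivrMr// mulrDr mulr1 mulrA -lerBlDl.
have h := cvg_at_left_filter (@lyap_cvg R alpha beta mu (L ^+ 2)).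
have gE' : E + g (x ^+ 2) < g (L ^+ 2) by rewrite -ltrBrDr.
have hgt := cvgr_gt _ h _ gE'.
near (L ^+ 2)^'- => l2.
have l2L : l2 < L ^+ 2 by near: l2; exact: nbhs_left_lt.
have l20 : 0 <= l2.
  by near: l2; apply: nbhs_left_ge; rewrite exprn_gt0.
have lt2 : E + g (x ^+ 2) < g l2 by near: l2; exact: hgt.
have e0 : 0 < (g l2 - g (x ^+ 2) - E) / 2 by rewrite divr_gt0// subr_gt0; lra.
have := hl l2 _ l20 l2L e0; lra.
Unshelve. all: by end_near. Qed.

End expected_hitting_time.

(** * Explicit test functions and comparison of the bounds *)

Lemma expR_diff_ge (R : realType) (a b : R) : 0 <= b -> b <= a ->
  a - b <= expR a - expR b.
Proof.
move=> b0 ba; have ab0 : 0 <= a - b by rewrite subr_ge0.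
have -> : expR a - expR b = expR b * (expR (a - b) - 1).
  by rewrite mulrBr mulr1 -expRD [b + _]addrC subrK.
have h : a - b <= expR (a - b) - 1 by rewrite lerBrDl expR_ge1Dx.
apply: (le_trans h); rewrite ler_peMl//; first exact: le_trans h.
by rewrite -expR0 ler_expR.
Qed.

Section generator_bounds.
Context (R : realType).
Variables (d : nat) (sigma theta lambda r : R).
Hypotheses (hd : (0 < d)%N) (sigma0 : 0 < sigma) (lambda0 : 0 < lambda).
Hypothesis thetaE : theta = lambda * sigma ^+ 2.

Let d0 : 0 < d%:R :> R. Proof. by rewrite ltr0n. Qed.
Let d20 : 0 < d%:R + 2 :> R. Proof. exact: addr_gt0. Qed.

(** For mu = lambda the terms in r exp(lambda r) cancel, leaving (2 exp(lambda r) + d - 2 lambda r)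
    / (d + 2). The ratio of alpha to beta makes the slope at r = 0 vanish, the common factor makes
    the value there 1. *)
Lemma upper_generator_ge1 :
  1 <= generator d (2 / (sigma ^+ 2 * d%:R * (d%:R + 2)) * lambda^-1)
         (2 / (sigma ^+ 2 * d%:R * (d%:R + 2)) * (d%:R / 2)) lambda sigma theta r.
Proof.
rewrite /generator /lyap1 /lyap2 thetaE.
have h : 1 + lambda * r <= expR (lambda * r) by exact: expR_ge1Dx.
set E := expR _ in h *.
rewrite [leRHS](_ : _ = (2 * E + d%:R - 2 * (lambda * r)) / (d%:R + 2)); last first.
  by field; rewrite !gt_eqF.
by rewrite ler_pdivlMr//; lra.
Qed.

(** For beta = 0, G is alpha mu sigma^2 d exp(mu r) (1 - 2 (lambda - mu) r / d). Here alpha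
    normalises G(0) to 1 and mu solves 2 (lambda - mu) / d = mu, so that G = exp(mu r) (1 - mu
    r). *)
Lemma lower_generator_le1 :
  generator d ((1 + 2 / d%:R) / (2 * lambda * sigma ^+ 2)) 0
    (2 * lambda / (d%:R + 2)) sigma theta r <= 1.
Proof.
rewrite /generator /lyap1 /lyap2 thetaE.
set mu := 2 * lambda / (d%:R + 2).
rewrite [leLHS](_ : _ = expR (mu * r) * (1 - mu * r)); last first.
  by set E := expR _; rewrite /mu; field; rewrite !gt_eqF.
have h : 1 - mu * r <= expR (- (mu * r)) by exact: expR_ge1Dx.
apply: (le_trans (ler_wpM2l (expR_ge0 _) h)).
by rewrite expRN mulfV// gt_eqF// expR_gt0.
Qed.

End generator_bounds.

Theorem theorem7 (R : realType) (disp : measure_display)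
    (Omega : measurableType disp) (P : probability Omega R)
    (d : nat) (hd : (1 <= d)%N)
    (sigma theta : R) (hsigma : 0 < sigma) (htheta : 0 < theta)
    (L x : R) (hL : 0 < L) (hx0 : 0 <= x) (hxL : x <= L)
    (B X : R -> Omega -> 'rV[R]_d)
    (hB : standard_BM P B)
    (hindep : independent2 P (sigma_process [set 0] X)
                             (sigma_process [set t | 0 <= t] B))
    (hX : OU_strong_solution P theta sigma B X)
    (hX0 : \forall w \ae P, eucl_norm (X 0 w) = x) :
  let lambda := theta / sigma ^+ 2 in
  let Etau := expected_hitting_time P X L in
  let upper1 := 2 / (sigma ^+ 2 * d%:R * (d%:R + 2))
    * (lambda^-1 * (expR (lambda * L ^+ 2) - expR (lambda * x ^+ 2))
       + d%:R / 2 * (L ^+ 2 - x ^+ 2)) in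
  let upper2 := theta^-1
    * (expR (lambda * L ^+ 2) - expR (lambda * x ^+ 2)) * d%:R^-1 in
  let lower1 := (1 + 2 / d%:R) / (2 * lambda * sigma ^+ 2)
    * (expR (2 * lambda / (d%:R + 2) * L ^+ 2)
       - expR (2 * lambda / (d%:R + 2) * x ^+ 2)) in
  let lower2 := (L ^+ 2 - x ^+ 2) / sigma ^+ 2 * d%:R^-1 in
  [/\ (Etau <= upper1%:E)%E, upper1 <= upper2,
      (lower1%:E <= Etau)%E & lower2 <= lower1].
Proof.
move=> lambda Etau upper1 upper2 lower1 lower2.
have s20 : 0 < sigma ^+ 2 by exact: exprn_gt0.
have d0 : 0 < d%:R :> R by rewrite ltr0n.
have d20 : 0 < d%:R + 2 :> R by exact: addr_gt0.
have lambda0 : 0 < lambda by exact: divr_gt0.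
have thetaE : theta = lambda * sigma ^+ 2 by rewrite divfK ?gt_eqF.
have x20 : 0 <= x ^+ 2 by exact: sqr_ge0.
have xL2 : x ^+ 2 <= L ^+ 2 by rewrite lerXn2r// nnegrE// ltW.
(* The exponential has slope at least 1 on the nonnegative half-line. With m = lambda this compares
   the two upper bounds, with m = 2 lambda / (d + 2) the two lower ones. *)
have diff_ge m : 0 < m ->
    m * (L ^+ 2 - x ^+ 2) <= expR (m * L ^+ 2) - expR (m * x ^+ 2).
  move=> m0; rewrite mulrBr expR_diff_ge ?ler_pM2l//.
  by apply: mulr_ge0 => //; exact: ltW.
have mu0 : 0 < 2 * lambda / (d%:R + 2) by rewrite divr_gt0// mulr_gt0.
split.
- pose c := 2 / (sigma ^+ 2 * d%:R * (d%:R + 2)).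
  have c0 : 0 < c by apply: divr_gt0 => //; do 2 apply: mulr_gt0 => //.
  have -> : upper1 = lyap (c * lambda^-1) (c * (d%:R / 2)) lambda (L ^+ 2)
                   - lyap (c * lambda^-1) (c * (d%:R / 2)) lambda (x ^+ 2).
    by rewrite /lyap /upper1 -/c; ring.
  apply: (expected_hitting_time_le hd hsigma htheta hL hx0 hxL hB hindep hX hX0).
  + by apply: mulr_ge0; rewrite ?invr_ge0 ltW//.
  + by apply/mulr_ge0/divr_ge0 => //; exact: ltW.
  + exact: ltW.
  + by move=> r _ _; exact: upper_generator_ge1.
- have := diff_ge _ lambda0; rewrite /upper1 /upper2 thetaE.
  set D := expR _ - _ => hD; rewrite -subr_ge0.
  rewrite [leRHS](_ : _ = (D - lambda * (L ^+ 2 - x ^+ 2))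
      / (lambda * sigma ^+ 2 * (d%:R + 2))); last by field; rewrite !gt_eqF.
  rewrite divr_ge0 ?subr_ge0//; apply/ltW; do 2 apply: mulr_gt0 => //.
- have -> : lower1 = lyap ((1 + 2 / d%:R) / (2 * lambda * sigma ^+ 2)) 0
                       (2 * lambda / (d%:R + 2)) (L ^+ 2)
                   - lyap ((1 + 2 / d%:R) / (2 * lambda * sigma ^+ 2)) 0
                       (2 * lambda / (d%:R + 2)) (x ^+ 2).
    by rewrite /lyap /lower1 !mul0r !addr0 mulrBr.
  apply: (expected_hitting_time_ge hd hsigma htheta hL hx0 hxL hB hindep hX hX0) => //.
  + apply: divr_ge0; first by rewrite addr_ge0// divr_ge0// ltW.
    by apply/ltW; do 2 apply: mulr_gt0 => //.
  + exact: ltW.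
  + by move=> r _ _; exact: lower_generator_le1.
- have := diff_ge _ mu0; rewrite /lower1 /lower2.
  set mu := 2 * lambda / _ => hD.
  rewrite (_ : (L ^+ 2 - x ^+ 2) / sigma ^+ 2 / d%:R =
     (1 + 2 / d%:R) / (2 * lambda * sigma ^+ 2) * (mu * (L ^+ 2 - x ^+ 2))); last first.
    by rewrite /mu; field; rewrite !gt_eqF.
  rewrite ler_wpM2l//; apply: divr_ge0; first by rewrite addr_ge0// divr_ge0// ltW.
  by apply/ltW; do 2 apply: mulr_gt0 => //.
Qed.
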